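(* Let $T$ be a complete first-order theory with monster model $\mathfrak{C}$, and assume that $T$ is simple. Let $A \subseteq B$ be (small) subsets of $\mathfrak{C}$. Let $p \in S(B)$ be a type that does not fork over $A$. Let $I$ be a (small) linearly ordered set. Then there is a Morley sequence $\mathbf{I} = \langle \bar{b}_i \mid i \in I \rangle$ for $p$ over $A$.
   Context: Setting: $T$ is a complete first-order theory in a language $L(T)$, and $\mathfrak{C}$ is its monster model, i.e. a $\kappa$-saturated, strongly $\kappa$-homogeneous model of $T$ for a suitably large cardinal $\kappa > |L(T)|+\aleph_0$. As usual, all sets of parameters and index sets are small (of cardinality less than $\kappa$), and all tuples and parameters are from $\mathfrak{C}$. $S(B)$ is the set of complete types over $B$ in finitely many variables (the variables of $p$ form a finite tuple). Forking: A formula $\phi(\bar{x},\bar{a})$ with parameters $\bar{a}$ divides over a set $A$ if there are $k<\omega$ and a sequence $\langle \bar{a}_i \mid i<\omega\rangle$ such that $\mathrm{tp}(\bar{a}_i/A)=\mathrm{tp}(\bar{a}/A)$ for all $i<\omega$ and $\{\phi(\bar{x},\bar{a}_i) \mid i<\omega\}$ is $k$-inconsistent (for any $i_1<\dots<i_k<\omega$, the formula $\bigwedge_{l=1}^{k}\phi(\bar{x},\bar{a}_{i_l})$ is not satisfiable in $\mathfrak{C}$). A type $p(\bar{x})$ forks over $A$ if there are finitely many formulas $\phi_0(\bar{x},\bar{a}_0),\dots,\phi_{n-1}(\bar{x},\bar{a}_{n-1})$ (with parameters anywhere in $\mathfrak{C}$), each dividing over $A$, such that $p(\bar{x}) \vdash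 \bigvee_{l<n}\phi_l(\bar{x},\bar{a}_l)$. Simplicity: $T$ is simple if no formula has the tree property. A formula $\phi(\bar{x},\bar{y})$ has the tree property if there are $2 \le k<\omega$ and tuples $(\bar{a}_s)_{s\in \omega^{<\omega}}$ in $\mathfrak{C}$ such that for every $s\in\omega^{<\omega}$ the set $\{\phi(\bar{x},\bar{a}_{s^\frown \langle i\rangle}) \mid i<\omega\}$ is $k$-inconsistent, and for every $\eta\in\omega^\omega$ the set $\{\phi(\bar{x},\bar{a}_{\eta\upharpoonright n}) \mid 1\le n<\omega\}$ is consistent. Morley sequences: Let $I$ be a linearly ordered set, $\mathbf{I}=\langle \bar{a}_i \mid i\in I\rangle$ a sequence of finite tuples of the same arity, $A\subseteq B$ sets, and $p\in S(B)$ a type that does not fork over $A$. Write $\bar{a}_{<i}$ for $(\bar{a}_j)_{j<i}$. $\mathbf{I}$ is an independent sequence for $p$ over $A$ if for all $i\in I$: (1) $\bar{a}_i\models p$, and (2) $\mathrm{tp}(\bar{a}_i/B\bar{a}_{<i})$ does not fork over $A$. $\mathbf{I}$ is a Morley sequence for $p$ over $A$ if it is an independent sequence for $p$ over $A$ and it is (order-)indiscernible over $B$. *)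

(* Defs.v *)
From mathcomp Require Import all_boot all_order.
From mathcomp Require Import boolp classical_sets functions cardinality.

Set Implicit Arguments.
Unset Strict Implicit.
Unset Printing Implicit Defensive.

Local Open Scope classical_set_scope.
Local Open Scope card_scope.

Record language := Language {
  func : Type;
  func_ar : func -> nat;
  rel_symb : Type;
  rel_ar : rel_symb -> nat }.

Inductive term (L : language) (n : nat) : Type :=
| Var of 'I_n
| App (f : func L) of ('I_(func_ar f) -> term L n).

(* [formula L n] is the type of formulas whose free variables are among
   v_0, ..., v_(n-1).  In [FAll phi] the bound variable is v_0 of [phi], and
   v_i of [FAll phi] is v_(i+1) of [phi]. *)
Inductive formula (L : language) : nat -> Type :=
| FFalse n : formula L n
| FEq n of term L n & term L n : formula L n
| FRel n (r : rel_symb L) of ('I_(rel_ar r) -> term L n) : formula L n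
| FImp n of formula L n & formula L n : formula L n
| FAll n of formula L n.+1 : formula L n.

Arguments FFalse {L n}.

Definition FNot L n (phi : formula L n) : formula L n := FImp phi FFalse.

Record structure (L : language) := Structure {
  carrier :> Type;
  interp_func : forall f : func L, (func_ar f).-tuple carrier -> carrier;
  interp_rel : forall r : rel_symb L, (rel_ar r).-tuple carrier -> Prop;
  carrier_inhabited : inhabited carrier }.

Fixpoint eval_term L (M : structure L) n (e : n.-tuple M) (t : term L n) : M :=
  match t with
  | Var i => tnth e i
  | App f ts => interp_func [tuple eval_term e (ts i) | i < func_ar f]
  end.

Fixpoint eval L (M : structure L) n (phi : formula L n) : n.-tuple M -> Prop :=
  match phi in formula _ n return n.-tuple M -> Prop with
  | FFalse _ => fun _ => False
  | FEq _ t u => fun e => eval_term e t = eval_term e u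
  | FRel _ r ts => fun e => interp_rel [tuple eval_term e (ts i) | i < rel_ar r]
  | FImp _ phi psi => fun e => eval phi e -> eval psi e
  | FAll _ phi => fun e => forall x : M, eval phi [tuple of x :: e]
  end.

Definition theory (L : language) := set (formula L 0).

Definition models L (M : structure L) (T : theory L) : Prop :=
  forall phi, T phi -> eval phi ([tuple] : 0.-tuple M).

Definition entails L (T : theory L) (phi : formula L 0) : Prop :=
  forall M : structure L, models M T -> eval phi ([tuple] : 0.-tuple M).

Definition complete_theory L (T : theory L) : Prop :=
  (exists M : structure L, models M T) /\
  (forall phi, entails T phi \/ entails T (FNot phi)).

(* [PForm phi a] is phi(x, a), where x is an n-tuple of free variables. *)
Record pformula L (M : structure L) (n : nat) := PForm {
  par_ar : nat;
  pform : formula L (n + par_ar);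
  par : par_ar.-tuple M }.

Definition sat L (M : structure L) n (phi : pformula M n) (x : n.-tuple M) :
  Prop := eval (pform phi) [tuple of x ++ par phi].

Definition pneg L (M : structure L) n (phi : pformula M n) : pformula M n :=
  PForm (FNot (pform phi)) (par phi).

Definition over L (M : structure L) n (B : set M) : set (pformula M n) :=
  [set phi | range (tnth (par phi)) `<=` B].

Definition realizes L (M : structure L) n (x : n.-tuple M)
  (p : set (pformula M n)) : Prop := forall phi, p phi -> sat phi x.

Definition consistent L (M : structure L) n (p : set (pformula M n)) : Prop :=
  forall q, finite_set q -> q `<=` p -> exists x, realizes x q.

(* p |- \/ Phi, for a finite set Phi, modulo the elementary diagram of M: some
   finite part q of p satisfies  M |= forall x, /\ q -> \/ Phi. *)
Definition implies_disj L (M : structure L) n (p Phi : set (pformula M n)) :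
  Prop :=
  exists q, [/\ finite_set q, q `<=` p &
    forall x, realizes x q -> exists2 phi, Phi phi & sat phi x].

(* The set S_n(B) of complete types over B. *)
Definition complete_types L (M : structure L) n (B : set M) :
  set (set (pformula M n)) :=
  [set p | [/\ p `<=` over B, consistent p &
    forall phi, over B phi -> p phi \/ p (pneg phi)]].

Definition tp L (M : structure L) n (x : n.-tuple M) (B : set M) :
  set (pformula M n) := [set phi | over B phi /\ sat phi x].

(* The cardinal kappa is given by a type K of that cardinality; under choice,
   |A| < kappa is the negation of kappa <= |A|. *)
Definition small (K X : Type) (A : set X) : Prop := ~ ([set: K] #<= A).

Definition saturated (K : Type) L (M : structure L) : Prop :=
  forall n (B : set M) (p : set (pformula M n)),
    small K B -> complete_types B p -> exists x, realizes x p.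

Definition partial_elementary L (M : structure L) (A : set M) (f : M -> M) :
  Prop :=
  forall n (phi : formula L n) (a : n.-tuple M),
    range (tnth a) `<=` A -> (eval phi a <-> eval phi (map_tuple f a)).

Definition automorphism L (M : structure L) (g : M -> M) : Prop :=
  [/\ bijective g,
      forall (f : func L) (a : (func_ar f).-tuple M),
        g (interp_func a) = interp_func (map_tuple g a) &
      forall (r : rel_symb L) (a : (rel_ar r).-tuple M),
        interp_rel a <-> interp_rel (map_tuple g a)].

Definition strongly_homogeneous (K : Type) L (M : structure L) : Prop :=
  forall (A : set M) (f : M -> M), small K A -> partial_elementary A f ->
    exists2 g, automorphism g & forall x, A x -> g x = f x.

(* The first condition is kappa > |L| + aleph_0. *)
Definition monster (K : Type) L (T : theory L) (C : structure L) : Prop :=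
  [/\ small K [set: (func L + rel_symb L) + nat], models C T,
      saturated K C & strongly_homogeneous K C].

Definition k_inconsistent L (M : structure L) n (k : nat)
  (phi : nat -> pformula M n) : Prop :=
  forall s : seq nat, size s = k -> sorted ltn s ->
    ~ exists x, forall i, i \in s -> sat (phi i) x.

Definition divides L (M : structure L) n (A : set M) (phi : pformula M n) :
  Prop :=
  exists (k : nat) (a : nat -> (par_ar phi).-tuple M),
    (forall i, tp (a i) A = tp (par phi) A) /\
    k_inconsistent k (fun i => PForm (pform phi) (a i)).

Definition forks L (M : structure L) n (A : set M) (p : set (pformula M n)) :
  Prop :=
  exists Phi, [/\ finite_set Phi, Phi `<=` divides A & implies_disj p Phi].

(* The nodes of the tree omega^<omega are finite sequences of naturals, and
   [mkseq eta j] is the restriction of eta to j. *)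
Definition tree_property L (C : structure L) n m (phi : formula L (n + m)) :
  Prop :=
  exists (k : nat) (a : seq nat -> m.-tuple C),
    [/\ (2 <= k)%N,
        forall s, k_inconsistent k (fun i => PForm phi (a (rcons s i))) &
        forall eta : nat -> nat,
          consistent [set PForm phi (a (mkseq eta j)) | j in [set j | (1 <= j)%N]]].

(* Simplicity of a complete theory, read in its monster model C. *)
Definition simple L (C : structure L) : Prop :=
  forall n m (phi : formula L (n + m)), ~ tree_property C phi.

Section Sequences.
Context {d : Order.disp_t} {I : orderType d}.

Lemma concat_tupleP X n k (b : I -> n.-tuple X) (s : k.-tuple I) :
  size (flatten [seq tval (b i) | i <- s]) == k * n.
Proof.
rewrite size_flatten sumnE !big_map (eq_bigr (fun=> n)) => [|i _].
  by rewrite big_const_seq count_predT size_tuple iter_addn_0 mulnC.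
exact: size_tuple.
Qed.

(* The concatenated tuple b_(s_0) ... b_(s_(k-1)). *)
Definition concat X n k (b : I -> n.-tuple X) (s : k.-tuple I) :
  (k * n).-tuple X := Tuple (concat_tupleP b s).

Definition indiscernible L (M : structure L) n (B : set M)
  (b : I -> n.-tuple M) : Prop :=
  forall k (s t : k.-tuple I), sorted <%O s -> sorted <%O t ->
    tp (concat b s) B = tp (concat b t) B.

(* The set of entries of the tuples b_j, j < i. *)
Definition before L (M : structure L) n (b : I -> n.-tuple M) (i : I) :
  set M := \bigcup_(j in [set j | (j < i)%O]) range (tnth (b j)).

Definition independent_sequence L (M : structure L) n (A B : set M)
  (p : set (pformula M n)) (b : I -> n.-tuple M) : Prop :=
  forall i, realizes (b i) p /\ ~ forks A (tp (b i) (B `|` before b i)).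

Definition morley_sequence L (M : structure L) n (A B : set M)
  (p : set (pformula M n)) (b : I -> n.-tuple M) : Prop :=
  independent_sequence A B p b /\ indiscernible B b.

End Sequences.

(* Main.v *)
(* Forking is replaced by an independence relation between sets: U is independent
   from W over A when k-dividing of a formula over A W is preserved by adding U to
   the base. It follows from non-forking, it is transitive by definition, and
   together with the finiteness of local ranks it yields the symmetry of forking
   without Morley sequences. An independent omega-sequence a for p is then turned
   into an indiscernible sequence b with the iterated average type of a along an
   ultrafilter on nat. If tp(b_i/B b_(<i)) forked over A, then by symmetry
   tp(w/A b_i) would fork for a finite tuple w from B b_(<i); the formula
   witnessing this is also satisfied by some entry of a and a tuple from B and
   earlier entries, so by symmetry again a would not be independent. *)
From Stdlib Require List.
Require Import Defs.
From mathcomp Require Import all_boot all_order.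
From mathcomp Require Import boolp classical_sets functions cardinality filter.

(* Otherwise [over] denotes the ssreflect lemma. *)
Import Defs.
Import Order.TTheory.

Set Implicit Arguments.
Unset Strict Implicit.
Unset Printing Implicit Defensive.

Local Open Scope classical_set_scope.
Local Open Scope card_scope.

(** * Small sets *)

(** A formula psi(x, w) that witnesses forking of tp(b_i/B b_(<i)) cannot be transferred to a
    directly: it does hold of some entry of a with a tuple w' in place of w, but w and w' need not
    be conjugate over A, so psi(x, w') need not fork. Symmetry moves the parameters of the forking
    formula to A b_i, and b_i is conjugate over A to every entry of a because both realize the
    complete type p. The sequence a has length omega because kappa is only assumed to exceed |L| +
    aleph_0: an independent sequence long enough for the Erdos-Rado theorem might not be small.
    Compactness always enters through [saturated_filter]. A proper filter on C^V replaces a finitely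
    satisfiable set of formulas in possibly infinitely many variables, and only its definable
    members matter. *)

Lemma setT_card_leP (K T : Type) (A : set T) :
  [set: K] #<= A <-> exists f : K -> T, injective f /\ forall k, A (f k).
Proof.
split=> [/card_leP/injfunPex[f _ fi]|[f [fi fA]]].
  exists (fun k => set_val (f (exist _ k (mem_setT k)))).
  split=> [x y /val_inj/fi|k]; last exact/set_mem/valP.
  by move=> /(_ (mem_setT _) (mem_setT _)) [].
have /injfunPex[g] : exists2 f, set_fun [set: K] A f & set_inj [set: K] f.
  by exists f => [x _|x y _ _ /fi].
exact: inj_card_le g.
Qed.

(** Zorn's lemma for graphs of partial injections: a maximal one exhausts S or T, since otherwise
    two unmatched points could be paired. *)
Lemma card_total (S T : Type) : [set: S] #<= [set: T] \/ [set: T] #<= [set: S].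
Proof.
pose inj2 (G : set (S * T)) := forall p q, G p -> G q -> p.1 = q.1 <-> p.2 = q.2.
have [F Finj Ftot|G [Ginj Gmax]] := @Zorn_bigcup _ inj2.
  move=> p q [X FX Xp] [Y FY Yq].
  have [XY|YX] := Ftot _ _ FX FY.
    exact: (Finj Y FY p q (XY _ Xp) Yq).
  exact: (Finj X FX p q Xp (YX _ Yq)).
have [sG|/existsNP[s sG]] := pselect (forall s, exists t, G (s, t)).
  have [f fG] := choice sG; left; apply/setT_card_leP; exists f.
  by split=> // x y /(Ginj (x, _) (y, _) (fG x) (fG y)).2.
have [tG|/existsNP[t tG]] := pselect (forall t, exists s, G (s, t)).
  have [f fG] := choice tG; right; apply/setT_card_leP; exists f.
  by split=> // x y /(Ginj (_, x) (_, y) (fG x) (fG y)).1.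
exfalso; apply: (Gmax (G `|` [set (s, t)])).
  split; first by move=> p; left.
  by move=> /(_ (s, t) (or_intror erefl)) Gst; apply: sG; exists t.
move=> [p1 p2] [q1 q2] [Gp|[-> ->]] [Gq|[-> ->]] /=.
- exact: (Ginj (p1, p2) (q1, q2)).
- split=> e; last by case: tG; exists p1; rewrite -e.
  by case: sG; exists p2; rewrite -e.
- split=> e; last by case: tG; exists q1; rewrite e.
  by case: sG; exists q2; rewrite e.
- by [].
Qed.

(* A maximal family of injective sequences with disjoint ranges covers all but
   finitely many points, and those fit in front of one of the sequences; so T
   is in bijection with a product by nat. *)
Lemma infinite_double (T : Type) : infinite_set [set: T] ->
  exists d : T * bool -> T, injective d.
Proof.
move=> Tinf.
pose lines (G : set (nat -> T)) := (forall f, G f -> injective f) /\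
  forall f g m n, G f -> G g -> f m = g n -> f = g.
have [F Fl Ftot|G [[Ginj Gdisj] Gmax]] := @Zorn_bigcup _ lines.
  split=> [f [X FX Xf]|f g m n [X FX Xf] [Y FY Yg]]; first exact: (Fl _ FX).1.
  have [XY|YX] := Ftot _ _ FX FY.
    exact: (Fl Y FY).2 (XY _ Xf) Yg.
  exact: (Fl X FX).2 Xf (YX _ Yg).
pose R := [set x | forall f n, G f -> x <> f n].
have Rfin : finite_set R.
  apply: contrapT => /infiniteP/setT_card_leP[g [ginj gR]].
  apply: (Gmax (G `|` [set g])); [split|split].
  - by move=> f; left.
  - by move=> /(_ g (or_intror erefl)) /(gR 0); apply.
  - by move=> f [/Ginj|->].
  - move=> f h m n [Gf|->] [Gh|->] // e; first exact: Gdisj Gf Gh e.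
      by case: (gR n f m Gf).
    by case: (gR m h n Gh).
have [f0 Gf0] : exists f, G f.
  apply: contrapT => /forallNP G0; apply: Tinf; apply: sub_finite_set Rfin.
  by move=> x _ f n /G0.
have [N [r [rinj rN]]] : exists N, exists r : T -> nat,
    (forall x y, R x -> R y -> r x = r y -> x = y) /\
    forall x, R x -> (r x < N)%N.
  have [N /pcard_leP/injfunPex[r' r'N r'i]] := (finite_set_leP R).1 Rfin.
  exists N, r'; split=> [x y Rx Ry|]; last exact: r'N.
  by apply: r'i; apply/mem_set.
(* The sequence [f0] is shifted by N, and its first N places receive the finitely many points of
   R. *)
pose code x (fm : (nat -> T) * nat) := G fm.1 /\
  ((fm.1 <> f0 /\ x = fm.1 fm.2) \/ (fm.1 = f0 /\
    (((N <= fm.2)%N /\ x = f0 (fm.2 - N)) \/ (R x /\ fm.2 = r x)))).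
have [c cP] : {c & forall x, code x (c x)}.
  apply: choice => x; have [Rx|] := pselect (R x).
    by exists (f0, r x); split=> //; right; split=> //; right.
  move=> /existsNP[f /existsNP[n /not_implyP[Gf /contrapT xf]]].
  have [ff0|ff0] := pselect (f = f0); last by exists (f, n); split=> //; left.
  exists (f0, n + N); split=> //=; right; split=> //; left.
  by rewrite leq_addl addnK -ff0.
have cinj x y : c x = c y -> x = y.
  move=> e; have [_ cx] := cP x; have [_] := cP y; rewrite -e => cy.
  move: cx cy; case: (c x) => f m /=.
  move=> [[f1 ex]|[f1 cx]] [[f2 ey]|[f2 cy]] //; first by rewrite ex ey.
  case: cx cy => [[lN ex]|[Rx ex]] [[lN' ey]|[Ry ey]].
  - by rewrite ex ey.
  - by move: lN; rewrite ey leqNgt rN.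
  - by move: lN'; rewrite ex leqNgt rN.
  - by apply: rinj => //; rewrite -ex -ey.
(* Within its sequence, a point with index m is sent to the places 2m and 2m + 1. *)
exists (fun xb : T * bool => (c xb.1).1 ((c xb.1).2.*2 + xb.2)) => -[x b] [y b'] /= e.
have e1 := Gdisj _ _ _ _ (cP x).1 (cP y).1 e.
rewrite -e1 in e; have {}e := Ginj _ (cP x).1 _ _ e.
have eb : b = b'.
  by have := congr1 odd e; rewrite !oddD !odd_double !oddb.
move: e; rewrite eb => /eqP; rewrite eqn_add2r => /eqP/double_inj e2.
by congr pair; apply: cinj; move: e1 e2; case: (c x); case: (c y) => /= ? ? ? ? -> ->.
Qed.

Lemma proj1_sig_inj (T : Type) (P : T -> Prop) : injective (@proj1_sig T P).
Proof. by move=> [x Px] [y Py] /= xy; apply: eq_exist. Qed.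

Section Small.
Variable K : Type.

Lemma small_le (S T : Type) (A : set S) (B : set T) :
  A #<= B -> small K B -> small K A.
Proof. by move=> AB sB KA; apply: sB; exact: card_le_trans KA AB. Qed.

Lemma small_sub (T : Type) (A B : set T) : A `<=` B -> small K B -> small K A.
Proof. by move=> /subset_card_le; exact: small_le. Qed.

Lemma small_image (S T : Type) (f : S -> T) (A : set S) :
  small K A -> small K (f @` A).
Proof. exact/small_le/card_image_le. Qed.

Hypothesis K_unc : ~ countable [set: K].

Lemma small_countable (T : Type) (A : set T) : countable A -> small K A.
Proof. by move=> Ac KA; apply: K_unc; exact: card_le_trans KA Ac. Qed.

Lemma small_setU (T : Type) (A B : set T) :
  small K A -> small K B -> small K (A `|` B).
Proof.
move=> sA sB /setT_card_leP[f [finj fAB]].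
have fA' k : ~ A (f k) -> B (f k) by have [] := fAB k.
have Kinf : infinite_set [set: K] by move=> /finite_set_countable.
pose P k := A (f k).
(* The larger of the two pieces P and ~ P of K is infinite, hence equinumerous
   with its double, which contains a copy of K. *)
have half (Q : K -> Prop) (g : {k | ~ Q k} -> {k | Q k}) : injective g ->
    exists h : K -> {k | Q k}, injective h.
  move=> ginj; have [|d dinj] := @infinite_double {k | Q k}.
    move=> Qfin; apply: Kinf.
    have Q'fin : finite_set [set: {k | ~ Q k}].
      by apply: card_le_finite Qfin; apply/setT_card_leP; exists g.
    have Ufin : finite_set (range (@proj1_sig _ Q) `|`
        range (@proj1_sig _ (fun k => ~ Q k))).
      by rewrite finite_setU; split; exact: finite_image.
    apply: sub_finite_set Ufin => k _.
    by have [Qk|Qk] := pselect (Q k); [left|right]; exists (exist _ k Qk).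
  exists (fun k => match pselect (Q k) with
    | left Qk => d (exist _ k Qk, true) | right Qk => d (g (exist _ k Qk), false)
    end) => x y.
  case: pselect => Qx; case: pselect => Qy /dinj[] //.
  by case/ginj.
have [le|le] := card_total {k | ~ P k} {k | P k};
    have [g [ginj _]] := (setT_card_leP _ _).1 le.
  have [h hinj] := half _ _ ginj; apply: sA; apply/setT_card_leP.
  exists (f \o @proj1_sig _ _ \o h); split=> [x y /= /finj|k].
    by move=> /proj1_sig_inj/hinj.
  exact: proj2_sig (h k).
have [g' g'inj] : {g' : {k | ~ ~ P k} -> {k | ~ P k} | injective g'}.
  exists (fun k => g (exist _ (proj1_sig k) (contrapT (proj2_sig k)))).
  by move=> [x Px] [y Py] /ginj [xy]; apply: eq_exist.
have [h hinj] := half _ _ g'inj; apply: sB; apply/setT_card_leP.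
exists (f \o @proj1_sig _ _ \o h); split=> [x y /= /finj|k].
  by move=> /proj1_sig_inj/hinj.
exact/fA'/(proj2_sig (h k)).
Qed.
End Small.

(** * Definable sets *)

Section Renaming.
Context {L : language}.

Fixpoint rename_term n m (f : 'I_n -> 'I_m) (t : term L n) : term L m :=
  match t with
  | Var i => Var L (f i)
  | App g ts => App (fun i => rename_term f (ts i))
  end.

Definition lift_renaming n m (f : 'I_n -> 'I_m) (i : 'I_n.+1) : 'I_m.+1 :=
  if unlift ord0 i is Some j then lift ord0 (f j) else ord0.

Fixpoint rename n (phi : formula L n) : forall m, ('I_n -> 'I_m) -> formula L m :=
  match phi in formula _ n return forall m, ('I_n -> 'I_m) -> formula L m with
  | FFalse _ => fun m f => FFalse
  | FEq _ t u => fun m f => FEq (rename_term f t) (rename_term f u)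
  | FRel _ r ts => fun m f => FRel (fun i => rename_term f (ts i))
  | FImp _ phi psi => fun m f => FImp (rename phi f) (rename psi f)
  | FAll _ phi => fun m f => FAll (rename phi (lift_renaming f))
  end.

Context {M : structure L}.

Lemma eval_rename_term n m (f : 'I_n -> 'I_m) (t : term L n) (e : m.-tuple M) :
  eval_term e (rename_term f t) = eval_term [tuple tnth e (f i) | i < n] t.
Proof.
elim: t => [i|g ts IH] /=; first by rewrite tnth_mktuple.
by congr interp_func; apply: eq_mktuple => i.
Qed.

Lemma eval_rename n (phi : formula L n) m (f : 'I_n -> 'I_m) (e : m.-tuple M) :
  eval (rename phi f) e <-> eval phi [tuple tnth e (f i) | i < n].
Proof.
elim: phi m f e => {n} [n|n t u|n r ts|n phi IH1 psi IH2|n phi IH] m f e //=.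
- by rewrite !eval_rename_term.
- rewrite (_ : [tuple _ | _ < _] =
    [tuple eval_term [tuple tnth e (f i) | i < n] (ts j) | j < rel_ar r]) //.
  by apply: eq_mktuple => i; rewrite eval_rename_term.
- by rewrite IH1 IH2.
- split=> H x; have := H x; rewrite IH;
    rewrite (_ : [tuple _ | _ < _] = [tuple of x :: [tuple tnth e (f i) | i < n]]) //;
    apply: eq_from_tnth => i; rewrite tnth_mktuple /lift_renaming;
    case: unliftP => [j|] ->; by rewrite ?tnth0 // !tnthS tnth_mktuple.
Qed.

End Renaming.

Section Definability.
Context {L : language} {C : structure L}.

Definition value V (e : V -> C) (s : V + C) : C :=
  match s with inl x => e x | inr c => c end.

Definition within V (D : set V) (B : set C) (s : V + C) : Prop :=
  match s with inl x => D x | inr c => B c end.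

(* The subset P of the power C ^ V is definable by a formula with parameters
   in B that depends only on the coordinates in D. *)
Definition definable V (D : set V) (B : set C) (P : set (V -> C)) : Prop :=
  exists m (phi : formula L m) (v : 'I_m -> V + C),
    (forall i, within D B (v i)) /\
    forall e, P e <-> eval phi [tuple value e (v i) | i < m].

Lemma definable_ext V (D : set V) B P Q :
  (forall e, P e <-> Q e) -> definable D B P -> definable D B Q.
Proof. by move=> PQ [m [phi [v [vw Pe]]]]; exists m, phi, v; split=> // e; rewrite -PQ. Qed.

Lemma definable_sub V (D D' : set V) (B B' : set C) P :
  D `<=` D' -> B `<=` B' -> definable D B P -> definable D' B' P.
Proof.
move=> DD BB [m [phi [v [vw Pe]]]]; exists m, phi, v; split=> // i.
by case: (v i) (vw i) => [x /DD|c /BB].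
Qed.

Lemma definable_false V (D : set V) B : definable D B (fun=> False).
Proof.
have v0 : 'I_0 -> V + C by case.
by exists 0, FFalse, v0; split=> // -[].
Qed.

Lemma definable_imp V (D : set V) B (P Q : set (V -> C)) :
  definable D B P -> definable D B Q -> definable D B (fun e => P e -> Q e).
Proof.
move=> [m1 [phi1 [v1 [vw1 Pe1]]]] [m2 [phi2 [v2 [vw2 Pe2]]]].
exists (m1 + m2), (FImp (rename phi1 (@lshift _ _)) (rename phi2 (@rshift _ _))).
exists (fun i => match fintype.split i with inl j => v1 j | inr j => v2 j end).
split=> [i|e /=]; first by case: fintype.split.
rewrite !eval_rename Pe1 Pe2.
rewrite (_ : [tuple _ | _ < m1] = [tuple value e (v1 i) | i < m1]); last first.
  by apply: eq_mktuple => i; rewrite tnth_mktuple (unsplitK (inl i)).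
rewrite (_ : [tuple _ | _ < m2] = [tuple value e (v2 i) | i < m2]) //.
by apply: eq_mktuple => i; rewrite tnth_mktuple (unsplitK (inr i)).
Qed.

Lemma definable_not V (D : set V) B P :
  definable D B P -> definable D B (~` P).
Proof. by move=> dP; apply: (definable_imp dP); exact: definable_false. Qed.

Lemma definable_and V (D : set V) B P Q :
  definable D B P -> definable D B Q -> definable D B (P `&` Q).
Proof.
move=> dP dQ; apply: definable_ext (definable_not (definable_imp dP (definable_not dQ))).
move=> e; split=> [H|[Pe Qe] H]; last exact: H Pe Qe.
by split; apply: contrapT => nh; apply: H => // ? ?.
Qed.

Lemma definable_true V (D : set V) B : definable D B setT.
Proof. by apply: definable_ext (definable_not (definable_false D B)) => e; split=> // _ []. Qed.

Lemma definable_eq V (D : set V) B s t :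
  within D B s -> within D B t -> definable D B (fun e => value e s = value e t).
Proof.
move=> sw tw.
exists 2, (FEq (Var L (ord0 : 'I_2)) (Var L (ord_max : 'I_2))).
exists (fun i => if i == ord0 then s else t); split=> [i|e /=]; first by case: ifP.
by rewrite !tnth_mktuple.
Qed.

Lemma definable_subst V V' (D : set V) (D' : set V') B (f : V -> V' + C) P :
  (forall x, D x -> within D' B (f x)) -> definable D B P ->
  definable D' B (fun e => P (fun x => value e (f x))).
Proof.
move=> fw [m [phi [v [vw Pe]]]].
exists m, phi, (fun i => match v i with inl x => f x | inr c => inr c end).
split=> [i|e]; first by case: (v i) (vw i) => //= x /fw.
rewrite Pe (_ : [tuple _ | _ < m] = [tuple value e
  match v i with inl x => f x | inr c => inr c end | i < m]) //.
by apply: eq_mktuple => i; case: (v i).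
Qed.

Lemma definable_agree V (D : set V) B P (e e' : V -> C) :
  definable D B P -> (forall x, D x -> e x = e' x) -> P e -> P e'.
Proof.
move=> [m [phi [v [vw Pe]]]] ee'; rewrite !Pe.
rewrite (_ : [tuple value e (v i) | i < m] = [tuple value e' (v i) | i < m]) //.
by apply: eq_mktuple => i; case: (v i) (vw i) => //= x /ee'.
Qed.

Definition update V (e : V -> C) (x : V) (c : C) : V -> C :=
  fun y => if `[< y = x >] then c else e y.

Lemma updateE V (e : V -> C) x c : update e x c x = c.
Proof. by rewrite /update asboolT. Qed.

Lemma updateN V (e : V -> C) x c y : y <> x -> update e x c y = e y.
Proof. by move=> yx; rewrite /update asboolF. Qed.

Lemma definable_forall V (D : set V) B x P : definable D B P ->
  definable (D `\ x) B (fun e => forall c, P (update e x c)).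
Proof.
move=> [m [phi [v [vw Pe]]]].
have aux k (w : 'I_k -> V + C) (f : 'I_m -> 'I_k.+1) :
    (forall i, within (D `\ x) B (w i)) ->
    (forall e c i, tnth [tuple of c :: [tuple value e (w j) | j < k]] (f i) =
      value (update e x c) (v i)) ->
    definable (D `\ x) B (fun e => forall c, P (update e x c)).
  move=> ww fE; exists k, (FAll (rename phi f)), w; split=> // e /=.
  split=> H c; have := H c; rewrite Pe eval_rename;
    rewrite (_ : [tuple value (update e x c) (v i) | i < m] =
     [tuple tnth [tuple of c :: [tuple value e (w j) | j < k]] (f i) | i < m]) //;
  by apply: eq_mktuple => i; rewrite fE.
(* The places that held x now refer to the bound variable; the free places they leave idle still
   need an admissible filler s. If there is no filler, every place held x and no free place is
   kept. *)
have [[s sw]|/forallNP Dx] := pselect (exists s, within (D `\ x) B s).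
  apply: (aux m (fun i => if `[< v i = inl x >] then s else v i)
    (fun i => if `[< v i = inl x >] then ord0 else lift ord0 i)) => [i|e c i].
    case: asboolP => // vx; have := vw i.
    by case: (v i) vx => //= y yx Dy; split=> // yx'; apply: yx; rewrite yx'.
  case: asboolP => [->|vx]; first by rewrite tnth0 /= updateE.
  rewrite tnthS tnth_mktuple asboolF //; case: (v i) vx => //= y yx.
  by rewrite updateN // => yx'; apply: yx; rewrite yx'.
have vx i : v i = inl x.
  apply: contrapT => vx; apply: (Dx (v i)); have := vw i.
  by case: (v i) vx => //= y yx Dy; split=> // yx'; apply: yx; rewrite yx'.
apply: (aux 0 (fun i => v (widen_ord (leq0n m) i)) (fun=> ord0)).
  by case.
by move=> e c i; rewrite tnth0 vx /= updateE.
Qed.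

Lemma definable_exists V (D : set V) B x P : definable D B P ->
  definable (D `\ x) B (fun e => exists c, P (update e x c)).
Proof.
move=> dP; apply: definable_ext (definable_not (definable_forall x (definable_not dP))).
move=> e; split=> [|[c Pc] /(_ c)//].
by move=> H; apply: contrapT => /forallNP.
Qed.

Lemma definable_exists_seq V B (s : seq V) (P : set (V -> C)) :
  definable setT B P -> definable setT B
    (fun e => exists e', (forall x, ~ List.In x s -> e' x = e x) /\ P e').
Proof.
move=> dP; elim: s => [|x s IH] /=.
  apply: definable_ext dP => e; split=> [Pe|[e' [ee']]]; first by exists e.
  by rewrite (_ : e' = e) //; apply/funext => x; exact: ee'.
apply: definable_ext (definable_sub (@subsetT _ _) (fun _ b => b) (definable_exists x IH)).
move=> e; split=> [[c [e' [ee' Pe']]]|[e' [ee' Pe']]].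
  exists e'; split=> // y /not_orP[yx ys]; rewrite ee' // updateN //.
  by move=> yx'; apply: yx.
exists (e' x), e'; split=> // y ys; have [->|yx] := pselect (y = x).
  by rewrite updateE.
by rewrite updateN // ee' // => -[xy|//]; apply: yx.
Qed.

Lemma definable_sat n B (phi : pformula C n) : over B phi ->
  definable setT B (fun e : 'I_n -> C => sat phi [tuple e i | i < n]).
Proof.
move=> phiB; exists (n + par_ar phi), (pform phi).
exists (fun i => match fintype.split i with inl j => inl j | inr j => inr (tnth (par phi) j) end).
split=> [i|e].
  by case: fintype.split => //= j; apply: phiB; exists j.
rewrite /sat (_ : [tuple of _ ++ _] = [tuple value e
  match fintype.split i with inl j => inl j | inr j => inr (tnth (par phi) j) end
  | i < n + par_ar phi]) //.
apply: eq_from_tnth => i; rewrite tnth_mktuple.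
by case: (splitP i) => j ij; [rewrite (_ : i = lshift _ j)|rewrite (_ : i = rshift _ j)];
  rewrite ?tnth_lshift ?tnth_rshift ?tnth_mktuple //; apply: val_inj.
Qed.

Lemma sat_definable n B (P : set ('I_n -> C)) : definable setT B P ->
  exists2 psi : pformula C n, over B psi & forall x, sat psi x <-> P (tnth x).
Proof.
move=> [m [phi [v [vw Pe]]]].
have aux k (b : k.-tuple C) (f : 'I_m -> 'I_(n + k)) : range (tnth b) `<=` B ->
    (forall (x : n.-tuple C) i, tnth [tuple of x ++ b] (f i) = value (tnth x) (v i)) ->
    exists2 psi : pformula C n, over B psi & forall x, sat psi x <-> P (tnth x).
  move=> bB fE; exists (PForm (rename phi f) b) => // x; rewrite /sat /= eval_rename Pe.
  rewrite (_ : [tuple value (tnth x) (v i) | i < m] =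
    [tuple tnth [tuple of x ++ b] (f i) | i < m]) //.
  by apply: eq_mktuple => i; rewrite fE.
(* All m places are given a parameter, so those occupied by variables need a filler c in B. If B is
   empty, no place carries a parameter. *)
have [[c Bc]|/forallNP B0] := pselect (exists c, B c).
  apply: (aux m [tuple if v i is inr d then d else c | i < m]
     (fun i => match v i with inl j => lshift m j | inr _ => rshift n i end)).
    move=> _ [i _ <-]; rewrite tnth_mktuple.
    by case: (v i) (vw i).
  move=> x i; case E : (v i) => [j|d]; first by rewrite tnth_lshift.
  by rewrite tnth_rshift tnth_mktuple E.
have [w wE] : {w : 'I_m -> 'I_n & forall i, v i = inl (w i)}.
  apply: (@choice _ _ (fun i j => v i = inl j)) => i.
  by case: (v i) (vw i) => [j _|d /B0//]; exists j.
apply: (aux 0 [tuple] (fun i => lshift 0 (w i))) => [_ [[]]//|x i].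
by rewrite tnth_lshift wE.
Qed.

End Definability.

(** * Saturation *)

Lemma In_mem (T : eqType) (s : seq T) x : List.In x s <-> x \in s.
Proof.
elim: s => [|y s IH] //=; rewrite in_cons IH; split.
  by move=> [->|->]; rewrite ?eqxx ?orbT.
by move=> /orP[/eqP->|]; [left|right].
Qed.

Lemma finite_set_list T (A : set T) :
  finite_set A <-> exists s : seq T, forall x, A x <-> List.In x s.
Proof.
elim/Peq : T A => T A.
rewrite finite_seqP; split=> -[s As]; exists s; first by move=> x; rewrite As In_mem.
by apply/seteqP; split=> x /=; [move=> /As/In_mem|move=> /In_mem/As].
Qed.

Section Saturation.
Context {K : Type} {L : language} {C : structure L}.
Hypothesis K_unc : ~ countable [set: K].
Hypothesis C_sat : saturated K C.

(** A formula mentions finitely many coordinates, so one member of the chain contains them all; this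
    is what makes Zorn's lemma applicable to partial assignments. *)
Lemma within_bigcup V (B : set C) (F : set (set (V * C))) X0 :
  F X0 -> total_on F subset ->
  forall m (v : 'I_m -> V + C),
  (forall i, within [set x | exists c, (\bigcup_(X in F) X) (x, c)] B (v i)) ->
  exists2 X, F X & forall i, within [set x | exists c, X (x, c)] B (v i).
Proof.
move=> FX0 Ftot m v vw.
have {vw} aux j : exists2 X, F X & forall i : 'I_m, (i < j)%N ->
    within [set x | exists c, X (x, c)] B (v i).
  elim: j => [|j [X FX Xv]]; first by exists X0 => // i; rewrite ltn0.
  have [jm|mj] := ltnP j m; last first.
    by exists X => // i ij; apply: Xv; exact: leq_trans (ltn_ord i) mj.
  have [Y FY Yv] : exists2 Y, F Y & within [set x | exists c, Y (x, c)] B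
      (v (Ordinal jm)).
    case: (v _) (vw (Ordinal jm)) => [x [c [Y FY Yx]]|c Bc]; last by exists X.
    by exists Y => //; exists c.
  have mono (X1 X2 : set (V * C)) s : X1 `<=` X2 ->
      within [set x | exists c, X1 (x, c)] B s ->
      within [set x | exists c, X2 (x, c)] B s.
    by move=> X12; case: s => //= x [c /X12 ?]; exists c.
  have lt (i : 'I_m) : (i < j.+1)%N -> i != Ordinal jm -> (i < j)%N.
    rewrite ltnS leq_eqVlt => /orP[/eqP ij /eqP nij|//].
    by case: nij; apply: ord_inj.
  have [XY|YX] := Ftot _ _ FX FY.
    exists Y => // i ij; have [->//|/(lt _ ij)/Xv] := eqVneq i (Ordinal jm).
    exact: mono.
  exists X => // i ij; have [->|/(lt _ ij)/Xv//] := eqVneq i (Ordinal jm).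
  exact: mono Yv.
by have [X FX Xv] := aux m; exists X => // i; apply: Xv; exact: ltn_ord.
Qed.

(* Extend F to an ultrafilter U and choose the coordinates of e one at a time,
   by saturation, so that e lies in every definable set of U. *)
Lemma saturated_filter V (B : set C) (F : set_system (V -> C)) :
  ProperFilter F -> small K [set: V] -> small K B ->
  exists e, forall P, definable setT B P -> F P -> P e.
Proof.
move=> /ultraFilterLemma[U [UU FU]] sV sB.
pose dom (G : set (V * C)) := [set x | exists c, G (x, c)].
pose agree (G : set (V * C)) (e : V -> C) := forall x c, G (x, c) -> e x = c.
(* A partial assignment is good if it already decides, in accordance with U, every definable set
   that depends only on the assigned coordinates. *)
pose good (G : set (V * C)) :=
  (forall x c c', G (x, c) -> G (x, c') -> c = c') /\
  forall P, definable (dom G) B P -> U P -> forall e, agree G e -> P e.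
have [H Hgood Htot|G [[Gfun Ggood] Gmax]] := @Zorn_bigcup _ good.
  split=> [x c c' [X HX Xc] [Y HY Yc]|P [m [phi [v [vw Pe]]]] UP e eH].
    have [XY|YX] := Htot _ _ HX HY.
      exact: (Hgood Y HY).1 (XY _ Xc) Yc.
    exact: (Hgood X HX).1 Xc (YX _ Yc).
  have [[X0 HX0]|/forallNP H0] := pselect (exists X, H X).
    have [X HX Xw] := within_bigcup HX0 Htot vw.
    have dP : definable (dom X) B P by exists m, phi, v.
    by apply: ((Hgood X HX).2 P dP UP e) => x c Xc; apply: eH; exists X.
  (* For the empty chain, P depends on no coordinate, so a single point of P gives all of them. *)
  have [e' Pe'] := filter_ex UP.
  suff dP : definable set0 B P by apply: definable_agree dP _ Pe'.
  exists m, phi, v; split=> // i.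
  by case: (v i) (vw i) => //= x [c [X /H0]].
have [Gtot|/existsNP[x0 x0G]] := pselect (forall x, exists c, G (x, c)).
  have [e eG] := choice Gtot; exists e => P dP /FU UP; apply: Ggood (UP) _ _.
    by apply: definable_sub dP => // x _; exact: Gtot.
  by move=> x c Gc; exact: Gfun Gc.
exfalso.
have [c0] := carrier_inhabited C.
have [e0 e0G] : exists e, agree G e.
  have [e eP] : {e : V -> C & forall x, dom G x -> G (x, e x)}.
    apply: (@choice _ _ (fun x c => dom G x -> G (x, c))) => x.
    have [[c Gc]|nG] := pselect (dom G x); first by exists c.
    by exists c0 => /nG.
  by exists e => x c Gc; apply: (Gfun x) => //; apply: eP; exists c.
pose ran := [set c | exists x, G (x, c)].
have sran : small K ran.
  have [g gP] : {g : C -> V & forall c, ran c -> G (g c, c)}.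
    apply: (@choice _ _ (fun c x => ran c -> G (x, c))) => c.
    have [[x Gx]|nG] := pselect (ran c); first by exists x.
    by exists x0 => /nG.
  have /injfunPex[h] : exists2 f, set_fun ran [set: V] f & set_inj ran f.
    exists g => // c c' /set_mem rc /set_mem rc' gcc.
    by apply: Gfun (gP _ rc) _; rewrite gcc; exact: gP.
  by apply: small_le sV; exact: inj_card_le h.
pose B' := B `|` ran.
have sB' : small K B' by exact: small_setU.
pose D := dom G `|` [set x0].
(* The type that U prescribes for the value at [x0], with the values chosen so far as parameters. *)
pose p := [set psi : pformula C 1 | over B' psi /\ exists P, [/\ definable D B P,
  U P & forall e, agree G e -> forall c, P (update e x0 c) -> sat psi [tuple c]]].
have upd e c x : dom G x -> update e x0 c x = e x.
  by move=> [d Gd]; rewrite updateN // => xx; apply: x0G; exists d; rewrite -xx.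
have ptype : complete_types B' p.
  split=> [psi []//|q /finite_set_list[l ql] qp|psi psiB'].
    have [P [dP UP Pq]] : exists P, [/\ definable D B P, U P & forall e,
        agree G e -> forall c, P (update e x0 c) -> realizes [tuple c] q].
      suff [P [dP UP Pq]] : exists P, [/\ definable D B P, U P & forall e,
          agree G e -> forall c, P (update e x0 c) ->
          forall psi, List.In psi l -> sat psi [tuple c]].
        by exists P; split=> // e eG c /(Pq e eG) h psi /ql; exact: h.
      have {ql} : forall psi, List.In psi l -> p psi by move=> psi /ql/qp.
      elim: l => [_|psi l IH lp].
        by exists setT; split=> //; [exact: definable_true|exact: filterT].
      have [P [dP UP Pq]] := IH (fun phi h => lp phi (or_intror h)).
      have [_ [Q [dQ UQ Qpsi]]] := lp psi (or_introl erefl).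
      exists (P `&` Q); split; [exact: definable_and|exact: filterI|].
      move=> e eG c [Pe Qe] phi [<-|]; [exact: Qpsi Qe|exact: Pq Pe _].
    (* Projecting [x0] away leaves a U-large set that depends only on [dom G], to which goodness of
       G applies. *)
    have [||c Pc] := Ggood (fun e => exists c, P (update e x0 c)) _ _ e0 e0G.
    - apply: definable_sub (definable_exists x0 dP) => // x [[//|->] nx].
      by case: nx.
    - apply: filterS UP => e Pe; exists (e x0).
      rewrite (_ : update _ _ _ = e) //; apply/funext => x.
      by rewrite /update; case: asboolP => [->|].
    - by exists [tuple c]; exact: Pq Pc.
  (* Parameters from [ran] are read back as coordinates, so that U can decide the formula or its
     negation. *)
  have [s sP] : {s : C -> V + C & forall c, B' c -> within (dom G) B (s c) /\
      forall e, agree G e -> value e (s c) = c}.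
    apply: (@choice _ _ (fun c s => B' c -> within (dom G) B s /\
      forall e, agree G e -> value e s = c)) => c.
    have [Bc|nBc] := pselect (B c); first by exists (inr c).
    have [[x Gx]|nG] := pselect (ran c); last by exists (inr c) => -[].
    by exists (inl x) => _; split=> [|e]; [exists c|exact].
  pose P (e : V -> C) := eval (pform psi) [tuple value e
    match fintype.split i with inl _ => inl x0 | inr j => s (tnth (par psi) j) end
    | i < 1 + par_ar psi].
  have Bpar j : B' (tnth (par psi) j) by apply: psiB'; exists j.
  have PE e c : agree G e -> P (update e x0 c) <-> sat psi [tuple c].
    move=> eG; rewrite /P /sat (_ : [tuple _ | _ < _] = [tuple of [tuple c] ++ par psi]) //.
    apply: eq_from_tnth => i; rewrite tnth_mktuple.
    case: (splitP i) => j ij.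
      have -> : i = lshift (par_ar psi) j by exact: val_inj.
      by rewrite tnth_lshift /= updateE ord1 tnth0.
    have -> : i = rshift 1 j by exact: val_inj.
    rewrite tnth_rshift.
    have [sw sv] := sP _ (Bpar j).
    rewrite -[RHS](sv e eG); case: (s _) sw => //= x Gx; exact: upd.
  have dP : definable D B P.
    exists _, (pform psi), (fun i => match fintype.split i with
      inl _ => inl x0 | inr j => s (tnth (par psi) j) end); split=> // i.
    case: fintype.split => [_|j] /=; first by right.
    have [] := sP _ (Bpar j); case: (s _) => //= x ? _; by left.
  have [UP|UP] := in_ultra_setVsetC P UU; [left|right]; split=> //.
    by exists P; split=> // e eG c; rewrite PE.
  exists (~` P); split=> //; first exact: definable_not.
  by move=> e eG c nP sP'; apply: nP; apply/PE.
have [t tp] := C_sat sB' ptype.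
pose c := thead t.
have tE : t = [tuple c] by apply: eq_from_tnth => i; rewrite ord1 tnth0.
apply: (Gmax (G `|` [set (x0, c)])).
  split=> [y|]; first by left.
  by move=> /(_ (x0, c) (or_intror erefl)) h; apply: x0G; exists c.
split=> [x d d'|P dP UP e eG].
  case=> [Gd|/pair_equal_spec[xx ->]] [Gd'|/pair_equal_spec[xx' ->]] //.
  - exact: Gfun Gd Gd'.
  - by exfalso; apply: x0G; exists d; rewrite -xx'.
  - by exfalso; apply: x0G; exists d'; rewrite -xx.
have {}dP : definable D B P.
  by apply: definable_sub dP => // x [d [Gd|[-> _]]]; [left; exists d|right].
have eG' : agree G e by move=> x d Gd; apply: eG; left.
(* With the coordinates in [dom G] read as parameters, P becomes a formula in the value at [x0]
   alone. It belongs to p, hence c satisfies it. *)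
pose f x : 'I_1 + C := if `[< x = x0 >] then inl ord0 else inr (e x).
have fw x : D x -> within setT B' (f x).
  rewrite /f; case: asboolP => // xx [[d Gd]|//] /=.
  by rewrite (eG' _ _ Gd); right; exists x.
have fE d : (fun x => value (tnth [tuple d]) (f x)) = update e x0 d.
  by apply/funext => x; rewrite /f /update; case: asboolP.
have BB' : B `<=` B' by move=> b; left.
have [psi psiB' psiE] := sat_definable
  (definable_subst (f := f) fw (definable_sub (fun _ h => h) BB' dP)).
have /tp : p psi.
  split=> //; exists P; split=> // e' e'G d Pd.
  rewrite psiE fE; apply: definable_agree dP _ Pd => x [Gx|->].
    by rewrite !upd //; case: Gx => b Gb; rewrite (e'G _ _ Gb) (eG' _ _ Gb).
  by rewrite !updateE.
rewrite tE psiE fE => Pc; apply: definable_agree dP _ Pc => x [Gx|->].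
  by rewrite upd.
by rewrite updateE; apply/esym/eG; right.
Qed.

Lemma saturated_filter_tuple n (B : set C) (F : set_system (n.-tuple C)) :
  ProperFilter F -> small K B ->
  exists x, forall phi, over B phi -> F [set x | sat phi x] -> sat phi x.
Proof.
move=> FF sB; pose G := [set P : set ('I_n -> C) | F [set x | P (tnth x)]].
have GG : ProperFilter G.
  split; first by move=> G0; exact: (filter_not_empty F).
  split=> [|P Q GP GQ|P Q PQ]; first exact: filterT.
    exact: filterI GP GQ.
  by apply: filterS => x; exact: PQ.
have sV : small K [set: 'I_n].
  by apply: small_countable => //; exact: countableP.
have [e eP] := saturated_filter GG sV sB.
exists [tuple e i | i < n] => phi phiB Fphi.
apply: (eP _ (definable_sat phiB)); rewrite /G /=; apply: filterS Fphi => x /=.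
rewrite (_ : [tuple tnth x i | i < n] = x) //.
by apply: eq_from_tnth => i; rewrite tnth_mktuple.
Qed.

End Saturation.

(** * Automorphisms and dividing *)

Section Automorphisms.
Context {L : language} {C : structure L}.

Definition fixes (A : set C) (g : C -> C) := forall x, A x -> g x = x.

Lemma eval_term_automorphism g n (t : term L n) (e : n.-tuple C) :
  automorphism g -> eval_term (map_tuple g e) t = g (eval_term e t).
Proof.
move=> [_ gf _]; elim: t => [i|f ts IH] /=; first by rewrite tnth_map.
rewrite gf; congr interp_func; apply: eq_from_tnth => i.
by rewrite !(tnth_map, tnth_mktuple) IH.
Qed.

Lemma eval_automorphism g n (phi : formula L n) (e : n.-tuple C) :
  automorphism g -> eval phi e <-> eval phi (map_tuple g e).
Proof.
move=> ga; elim: phi e => {n} [n|n t u|n r ts|n phi IH1 psi IH2|n phi IH] e //=.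
- rewrite !eval_term_automorphism //; have [/bij_inj gi _ _] := ga.
  by split=> [->|/gi].
- have [_ _ gr] := ga; rewrite gr.
  rewrite (_ : map_tuple g [tuple eval_term e (ts i) | i < rel_ar r] =
    [tuple eval_term (map_tuple g e) (ts i) | i < rel_ar r]) //.
  apply: eq_from_tnth => i; rewrite tnth_map !tnth_mktuple.
  by rewrite eval_term_automorphism.
- by rewrite IH1 IH2.
have gx x : map_tuple g [tuple of x :: e] = [tuple of g x :: map_tuple g e].
  exact: val_inj.
have [[h gK hK] _ _] := ga.
by split=> H x; [rewrite -[x]hK -gx -IH|rewrite IH gx].
Qed.

Lemma automorphism_comp g h :
  automorphism g -> automorphism h -> automorphism (g \o h : C -> C).
Proof.
move=> [gb gf gr] [hb hf hr]; split=> [|f a|r a]; first exact: bij_comp.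
  rewrite /= hf gf; congr interp_func; apply: eq_from_tnth => i.
  by rewrite !tnth_map.
rewrite hr gr (_ : map_tuple g _ = map_tuple (g \o h) a) //.
by apply: eq_from_tnth => i; rewrite !tnth_map.
Qed.

Lemma automorphism_inv g : automorphism g ->
  exists h, [/\ automorphism (h : C -> C), cancel g h & cancel h g].
Proof.
move=> [[h gK hK] gf gr]; exists h.
have hKt n (a : n.-tuple C) : map_tuple g (map_tuple h a) = a.
  by apply: eq_from_tnth => i; rewrite !tnth_map hK.
split=> //; split=> [|f a|r a]; first by exists g.
  by apply: (can_inj gK); rewrite gf hK hKt.
by rewrite [X in _ <-> X]gr hKt.
Qed.

Lemma automorphism_id : automorphism (id : C -> C).
Proof.
have idt n (a : n.-tuple C) : map_tuple id a = a.
  by apply: eq_from_tnth => i; rewrite tnth_map.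
by split=> [|f a|r a]; [exists id|rewrite idt|rewrite idt].
Qed.

Lemma sat_automorphism g n m (phi : formula L (n + m)) a (x : n.-tuple C) :
  automorphism g ->
  sat (PForm phi a) x <-> sat (PForm phi (map_tuple g a)) (map_tuple g x).
Proof.
move=> ga; rewrite /sat /= (eval_automorphism _ _ ga).
rewrite (_ : map_tuple g [tuple of x ++ a] =
  [tuple of map_tuple g x ++ map_tuple g a]) //.
by apply: val_inj; rewrite /= map_cat.
Qed.

Definition conjugate (A : set C) m (u v : m.-tuple C) :=
  exists g, [/\ automorphism g, fixes A g & map_tuple g u = v].

Lemma conjugate_sub (A B : set C) m (u v : m.-tuple C) :
  A `<=` B -> conjugate B u v -> conjugate A u v.
Proof. by move=> AB [g [ga gB uv]]; exists g; split=> // x /AB/gB. Qed.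

Lemma conjugate_sat (A : set C) m (u v : m.-tuple C) phi :
  conjugate A u v -> over A phi -> sat phi u <-> sat phi v.
Proof.
move=> [g [ga gA <-]] phiA; case: phi phiA => k phi a phiA.
rewrite (sat_automorphism _ _ _ ga) (_ : map_tuple g a = a) //.
by apply: eq_from_tnth => i; rewrite tnth_map; apply/gA/phiA; exists i.
Qed.

Lemma tp_definable (A : set C) m (u v : m.-tuple C) P :
  (forall phi, over A phi -> sat phi u -> sat phi v) ->
  definable setT A P -> P (tnth u) -> P (tnth v).
Proof.
by move=> uv /sat_definable[psi psiA psiE]; rewrite -!psiE; exact: uv.
Qed.

(** The map that fixes A and sends u to v is partial elementary. It is defined through names: s
    picks for each point one coordinate of u or one parameter, so repetitions in u and entries of u
    in A cause no conflict. *)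
Lemma tp_conjugate K (A : set C) m (u v : m.-tuple C) :
  strongly_homogeneous K C -> small K (A `|` range (tnth u)) ->
  (forall phi, over A phi -> sat phi u -> sat phi v) -> conjugate A u v.
Proof.
move=> hom sA uv.
have [s sP] : {s : C -> 'I_m + C & forall x, (A `|` range (tnth u)) x ->
    within setT A (s x) /\ value (tnth u) (s x) = x}.
  apply: (@choice _ _ (fun x s => (A `|` range (tnth u)) x ->
    within setT A s /\ value (tnth u) s = x)) => x.
  have [Ax|nAx] := pselect (A x); first by exists (inr x).
  have [[j _ jx]|nux] := pselect (range (tnth u) x); first by exists (inl j).
  by exists (inr x) => -[].
have tr P : definable setT A P -> P (tnth u) <-> P (tnth v).
  move=> dP; split; first exact: tp_definable uv dP.
  move=> Pv; apply: contrapT => nPu.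
  exact: (tp_definable uv (definable_not dP) nPu Pv).
pose f x := value (tnth v) (s x).
have [k phi a aA|g ga gf] := hom _ f sA.
  have aE i : value (tnth u) (s (tnth a i)) = tnth a i.
    by apply: (sP _ _).2; apply: aA; exists i.
  pose P (e : 'I_m -> C) := eval phi [tuple value e (s (tnth a i)) | i < k].
  have dP : definable setT A P.
    exists k, phi, (fun i => s (tnth a i)); split=> // i.
    by apply: (sP _ _).1; apply: aA; exists i.
  have := tr P dP; rewrite /P.
  rewrite (_ : [tuple value (tnth u) _ | _ < _] = a); last first.
    by apply: eq_from_tnth => i; rewrite tnth_mktuple aE.
  rewrite (_ : [tuple value (tnth v) _ | _ < _] = map_tuple f a) //.
  by apply: eq_from_tnth => i; rewrite tnth_mktuple tnth_map.
exists g; split=> // [x Ax|].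
  have xin : (A `|` range (tnth u)) x by left.
  have [sw sv] := sP _ xin; rewrite gf //.
  exact: (tr _ (definable_eq (t := inr x) sw Ax)).1.
apply: eq_from_tnth => j; rewrite tnth_map.
have jin : (A `|` range (tnth u)) (tnth u j) by right; exists j.
have [sw sv] := sP _ jin; rewrite gf //.
exact: (tr _ (definable_eq (t := inl j) sw Logic.I)).1.
Qed.

(** Conjugacy replaces equality of types so that witnesses can be moved by automorphisms, and k is
    kept explicit because the patterns of the local rank record it. *)
Definition kdivides (A : set C) k n (phi : pformula C n) :=
  exists a : nat -> (par_ar phi).-tuple C,
    (forall i, conjugate A (par phi) (a i)) /\
    k_inconsistent k (fun i => PForm (pform phi) (a i)).

Lemma dividesP K (A : set C) n (phi : pformula C n) :
  strongly_homogeneous K C -> small K (A `|` range (tnth (par phi))) ->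
  divides A phi <-> exists k, kdivides A k phi.
Proof.
move=> hom sA; split=> [[k [a [ta ka]]]|[k [a [ca ka]]]]; exists k, a; split=> // i.
  apply: tp_conjugate hom sA _ => psi psiA psis.
  have : tp (par phi) A psi by split.
  by rewrite -(ta i) => -[].
apply/seteqP; split=> psi [psiA psis]; split=> //.
  by rewrite (conjugate_sat (ca i) psiA).
by rewrite -(conjugate_sat (ca i) psiA).
Qed.

Lemma k_inconsistent_automorphism g n m k (phi : formula L (n + m))
    (a : nat -> m.-tuple C) : automorphism g ->
  k_inconsistent k (fun i => PForm phi (a i)) ->
  k_inconsistent k (fun i => PForm phi (map_tuple g (a i))).
Proof.
move=> ga ka s ss sl [x xs]; have [h [ha gK hK]] := automorphism_inv ga.
apply: (ka s ss sl); exists (map_tuple h x) => i /xs.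
rewrite (sat_automorphism _ _ _ ha) (_ : map_tuple h (map_tuple g _) = a i) //.
by apply: eq_from_tnth => j; rewrite !tnth_map gK.
Qed.

End Automorphisms.

(** * Local ranks *)

Section Rank.
Context {L : language} {C : structure L} {n : nat}.

Lemma k_inconsistent_subseq k (phi : nat -> pformula C n) h :
  {homo h : i j / (i < j)%N} -> k_inconsistent k phi ->
  k_inconsistent k (phi \o h).
Proof.
move=> hh kphi s ss sl [x xs]; apply: (kphi (map h s)).
- by rewrite size_map.
- by rewrite sorted_map; apply: sub_sorted sl => i j; exact: hh.
- by exists x => _ /mapP[i /xs ? ->].
Qed.

Lemma k_inconsistent_leq k k' (phi : nat -> pformula C n) :
  (k <= k')%N -> k_inconsistent k phi -> k_inconsistent k' phi.
Proof.
move=> kk kphi s ss sl [x xs]; apply: (kphi (take k s)).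
- by rewrite size_takel // ss.
- exact: take_sorted.
- by exists x => i /mem_take/xs.
Qed.

Definition pattern := {m : nat & (formula L (n + m) * nat)%type}.

Definition instance (d : pattern) (a : (tag d).-tuple C) : pformula C n :=
  PForm (tagged d).1 a.

Definition pattern_of k (phi : pformula C n) : pattern :=
  existT _ (par_ar phi) (pform phi, k).

(* The local rank D(theta, Delta, k) of Shelah, for an arbitrary set theta of
   tuples; each pattern carries its own k. *)
Fixpoint rank_ge (D : set pattern) (N : nat) (theta : set (n.-tuple C)) : Prop :=
  if N is N'.+1 then exists2 d, D d & exists a : nat -> (tag d).-tuple C,
    k_inconsistent (tagged d).2 (fun i => instance (a i)) /\
    forall i, rank_ge D N' (theta `&` [set x | sat (instance (a i)) x])
  else exists x, theta x.

Lemma rank_ge_automorphism D N (theta theta' : set (n.-tuple C)) g :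
  automorphism g -> (forall x, theta x -> theta' (map_tuple g x)) ->
  rank_ge D N theta -> rank_ge D N theta'.
Proof.
move=> ga; elim: N theta theta' => [|N IH] theta theta' gt /=.
  by move=> [x /gt]; exists (map_tuple g x).
move=> [d Dd [a [ka ra]]]; exists d => //; exists (map_tuple g \o a).
split=> [|i]; first exact: k_inconsistent_automorphism.
apply: IH (ra i) => x [/gt tx sx]; split=> //.
by rewrite /= /instance -sat_automorphism.
Qed.

Lemma rank_ge_sub D N (theta theta' : set (n.-tuple C)) :
  theta `<=` theta' -> rank_ge D N theta -> rank_ge D N theta'.
Proof.
move=> tt; apply: rank_ge_automorphism automorphism_id _ => x /tt.
by rewrite (_ : map_tuple id x = x) //; apply: eq_from_tnth => i; rewrite tnth_map.
Qed.

Lemma rank_ge_nonempty D N theta : rank_ge D N theta -> exists x, theta x.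
Proof.
elim: N theta => [//|N IH] theta /= [d _ [a [_ /(_ 0)/IH[x [tx _]]]]].
by exists x.
Qed.

Lemma infinitely_often (P : nat -> Prop) :
  (forall i, exists j, (i <= j)%N /\ P j) ->
  exists h : nat -> nat, {homo h : i j / (i < j)%N} /\ forall i, P (h i).
Proof.
move=> Pinf; have [f fP] := choice Pinf.
pose h := fix h i := if i is i'.+1 then f (h i').+1 else f 0.
exists h; split; last by case=> [|i] /=; exact: (fP _).2.
apply: homo_ltn => [|i]; first exact: ltn_trans.
exact: (fP (h i).+1).1.
Qed.

(** One of the two halves keeps the rank for infinitely many branches, and a subsequence of a
    k-inconsistent sequence is k-inconsistent. *)
Lemma rank_ge_setU D N (theta X Y : set (n.-tuple C)) : theta `<=` X `|` Y ->
  rank_ge D N theta -> rank_ge D N (theta `&` X) \/ rank_ge D N (theta `&` Y).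
Proof.
elim: N theta => [|N IH] theta tXY /=.
  by move=> [x tx]; have [] := tXY x tx; [left|right]; exists x.
move=> [d Dd [a [ka ra]]].
have aux (Z : set (n.-tuple C)) :
    (forall i, exists j, (i <= j)%N /\
      rank_ge D N (theta `&` [set x | sat (instance (a j)) x] `&` Z)) ->
    exists2 d, D d & exists a : nat -> (tag d).-tuple C,
    k_inconsistent (tagged d).2 (fun i => instance (a i)) /\
    forall i, rank_ge D N (theta `&` Z `&` [set x | sat (instance (a i)) x]).
  move=> /infinitely_often[h [hh rh]]; exists d => //; exists (a \o h).
  split=> [|i]; first exact: k_inconsistent_subseq hh ka.
  by apply: rank_ge_sub (rh i) => x [[tx sx] Zx].
have [Xinf|] := pselect (forall i, exists j, (i <= j)%N /\
      rank_ge D N (theta `&` [set x | sat (instance (a j)) x] `&` X)).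
  by left; exact: aux.
move=> /existsNP[i0 /forallNP Xfin]; right; apply: aux => i.
exists (maxn i i0); split; first exact: leq_maxl.
have [] // := IH (theta `&` [set x | sat (instance (a (maxn i i0))) x]) _ (ra _).
  by move=> x [/tXY].
by move=> rX; case: (Xfin (maxn i i0)); split=> //; exact: leq_maxr.
Qed.

Lemma rank_ge_cover D N (theta : set (n.-tuple C)) T (l : seq T)
    (X : T -> set (n.-tuple C)) :
  (forall x, theta x -> exists2 t, List.In t l & X t x) ->
  rank_ge D N theta -> exists2 t, List.In t l & rank_ge D N (theta `&` X t).
Proof.
elim: l theta => [|t l IH] theta tl rt.
  by have [x /tl[]] := rank_ge_nonempty rt.
pose Y := [set x | exists2 t, List.In t l & X t x].
have [|r|r] := @rank_ge_setU D N theta (X t) Y _ rt.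
- by move=> x /tl[u [<-|ul] Xu]; [left|right; exists u].
- by exists t => //; left.
have [|u ul ru] := IH _ _ r; first by move=> x [].
by exists u; [right|apply: rank_ge_sub ru => x [[tx _]]].
Qed.

(** Suppose that the first pattern is in D1. Either some branch has D2-rank at least n2, and then so
    has theta; or by induction all branches have D1-rank at least n1 - 1, and together they give
    theta rank n1. Thus finite sets of patterns reduce to single ones. *)
Lemma rank_ge_split D1 D2 n1 n2 (theta : set (n.-tuple C)) :
  rank_ge (D1 `|` D2) (n1 + n2) theta ->
  rank_ge D1 n1 theta \/ rank_ge D2 n2 theta.
Proof.
move Nn : (n1 + n2)%N => N; elim: N n1 n2 Nn theta => [|N IH] [|n1] [|n2] // Nn theta rt;
  try by [left; exact: rank_ge_nonempty rt|right; exact: rank_ge_nonempty rt].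
move: rt => /= [d [Dd|Dd] [a [ka ra]]].
  have [[i r2]|/forallNP nr2] := pselect (exists i,
      rank_ge D2 n2.+1 (theta `&` [set x | sat (instance (a i)) x])).
    by right; apply: rank_ge_sub r2 => x [].
  left; exists d => //; exists a; split=> // i.
  have [|//|/nr2//] := IH n1 n2.+1 _ _ (ra i).
  by move: Nn; rewrite addSn => -[].
have [[i r1]|/forallNP nr1] := pselect (exists i,
    rank_ge D1 n1.+1 (theta `&` [set x | sat (instance (a i)) x])).
  by left; apply: rank_ge_sub r1 => x [].
right; exists d => //; exists a; split=> // i.
have [|/nr1//|//] := IH n1.+1 n2 _ _ (ra i).
by move: Nn; rewrite addnS => -[].
Qed.

Lemma rank_ge_tree m (phi : formula L (n + m)) k N theta :
  rank_ge [set existT _ m (phi, k)] N theta ->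
  exists a : seq nat -> m.-tuple C,
    (forall s, (size s < N)%N -> k_inconsistent k (fun i => PForm phi (a (rcons s i)))) /\
    forall s, (size s <= N)%N -> exists2 x, theta x &
      forall j, (0 < j <= size s)%N -> sat (PForm phi (a (take j s))) x.
Proof.
have [c0] := carrier_inhabited C.
elim: N theta => [|N IH] theta.
  move=> /= [x tx]; exists (fun=> [tuple c0 | _ < m]); split=> // -[|//] _.
  by exists x => // -[].
move=> rt; have [x0 tx0] := rank_ge_nonempty rt.
move: rt => /= [d -> [e [ke re]]].
have [b bP] := choice (fun i => IH _ (re i)).
(* The value at the root is a filler: the conditions mention nonempty nodes only. *)
exists (fun s => if s is i :: s' then if s' is [::] then e i else b i s'
  else [tuple c0 | _ < m]); split.
  case=> [|i s] sN; first exact: ke.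
  have [kb _] := bP i; move: (kb s sN).
  by congr k_inconsistent; apply/funext => j; case: s {sN}.
case=> [|i s] sN; first by exists x0 => // -[].
have [_ pb] := bP i; have [x [tx sx] xP] := pb s sN.
exists x => // -[|[|j]] //=; first by rewrite take0.
rewrite ltnS => js; have := xP j.+1 js.
by case: s js {sN xP}.
Qed.

End Rank.

Section Simple.
Context {K : Type} {L : language} {C : structure L}.
Hypothesis K_unc : ~ countable [set: K].
Hypothesis C_sat : saturated K C.

Lemma definable_all V (D : set V) (B : set C) T (l : seq T) (P : T -> set (V -> C)) :
  (forall t, List.In t l -> definable D B (P t)) ->
  definable D B (fun e => forall t, List.In t l -> P t e).
Proof.
elim: l => [|t l IH] dP.
  by apply: definable_ext (definable_true D B) => e; split.
apply: definable_ext (definable_and (dP t (or_introl erefl)) (IH (fun u ul => dP u (or_intror ul)))) => e.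
split=> [[Pt Pl] u [<-|/Pl]//|H].
by split=> [|u ul]; apply: H; [left|right].
Qed.

Definition join_tuple n V (x : n.-tuple C) (e : 'I_n + V -> C) : 'I_n + V -> C :=
  fun s => match s with inl i => tnth x i | inr v => e (inr v) end.

Lemma definable_exists_tuple n V (B : set C) (P : set ('I_n + V -> C)) :
  definable setT B P ->
  definable setT B (fun e => exists x : n.-tuple C, P (join_tuple x e)).
Proof.
move=> dP; apply: definable_ext (definable_exists_seq [seq inl i | i <- enum 'I_n] dP).
move=> e; split=> [[e' [ee' Pe']]|[x Px]].
  exists [tuple e' (inl i) | i < n]; rewrite (_ : join_tuple _ _ = e') //.
  apply/funext => -[i|v] /=; first by rewrite tnth_mktuple.
  by rewrite ee' // => /List.in_map_iff[i []].
exists (join_tuple x e); split=> // -[i []|//].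
by apply/List.in_map_iff; exists i; split=> //; apply/In_mem; rewrite mem_enum.
Qed.

(** The coordinates in ['I_n] are scratch space for the quantified tuple; their values in e are
    irrelevant. *)
Lemma definable_consistent n m V (phi : formula L (n + m)) T (l : seq T)
    (node : T -> 'I_m -> V) :
  definable setT set0 (fun e : 'I_n + V -> C => exists x : n.-tuple C,
    forall t, List.In t l -> sat (PForm phi [tuple e (inr (node t i)) | i < m]) x).
Proof.
pose sat_at t (e : 'I_n + V -> C) :=
  sat (PForm phi [tuple e (inr (node t i)) | i < m]) [tuple e (inl i) | i < n].
have dsat t : definable setT set0 (sat_at t).
  pose v (i : 'I_(n + m)) : 'I_n + V := match fintype.split i with
    inl j => inl j | inr j => inr (node t j) end.
  exists (n + m), phi, (fun i => inl (v i)); split=> // e.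
  rewrite /sat_at /sat /= (_ : [tuple of _ ++ _] = [tuple e (v i) | i < n + m]) //.
  apply: eq_from_tnth => i; rewrite tnth_mktuple /v.
  by case: (splitP i) => j ij; [rewrite (_ : i = lshift _ j)|rewrite (_ : i = rshift _ j)];
    rewrite ?tnth_lshift ?tnth_rshift ?tnth_mktuple //; apply: val_inj.
apply: definable_ext (definable_exists_tuple (definable_all (fun t _ => dsat t))) => e.
have sat_join t x : sat_at t (join_tuple x e) =
    sat (PForm phi [tuple e (inr (node t i)) | i < m]) x.
  rewrite /sat_at; congr sat.
  by apply: eq_from_tnth => i; rewrite tnth_mktuple.
by split=> -[x xP]; exists x => t tl; have := xP t tl; rewrite sat_join.
Qed.

(** Unbounded rank for one pattern gives trees of every finite height, and compactness, with one
    variable per coordinate of each node, turns them into an infinite tree. *)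
Lemma simple_rank1 n (d : @pattern L n) :
  simple C -> exists N, ~ rank_ge [set d] N [set: n.-tuple C].
Proof.
case: d => m [phi k] Csimple; apply: contrapT => /forallNP rinf.
apply: (Csimple n m phi).
pose V := ('I_n + seq nat * 'I_m)%type.
pose node (e : V -> C) s := [tuple e (inr (s, i)) | i < m].
pose good N (e : V -> C) :=
  (forall s, (size s < N)%N -> k_inconsistent k (fun i => PForm phi (node e (rcons s i)))) /\
  forall s, (size s <= N)%N -> exists x, 
      forall j, (0 < j <= size s)%N -> sat (PForm phi (node e (take j s))) x.
pose F := [set P : set (V -> C) | exists N, forall e, good N e -> P e].
have good_leq N N' e : (N <= N')%N -> good N' e -> good N e.
  move=> NN [g1 g2]; split=> s sN; first by apply: g1; exact: leq_trans sN NN.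
  by apply: g2; exact: leq_trans sN NN.
have FF : ProperFilter F.
  split=> [[N]|].
    have [a [a1 a2]] := rank_ge_tree (contrapT (rinf N)).
    have [c0] := carrier_inhabited C.
    pose e (v : V) := if v is inr (s, i) then tnth (a s) i else c0.
    have nodeE s : node e s = a s by apply: eq_from_tnth => i; rewrite tnth_mktuple.
    move=> /(_ e); apply; split=> [s /a1|s /a2[x _ xP]].
      rewrite (_ : (fun i => _) = fun i => PForm phi (a (rcons s i))) //.
      by apply/funext => i; rewrite nodeE.
    by exists x => j jN; rewrite nodeE; exact: xP.
  split=> [|P Q [N1 P1] [N2 P2]|P Q PQ [N NP]]; first by exists 0.
    exists (maxn N1 N2) => e ge; split; first exact/P1/(good_leq _ _ _ (leq_maxl _ _) ge).
    exact/P2/(good_leq _ _ _ (leq_maxr _ _) ge).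
  by exists N => e /NP/PQ.
have sV : small K [set: V] by apply: small_countable => //; exact: countableP.
have s0 : small K (set0 : set C) by apply: small_countable => //; exact: countable0.
have [e eP] := saturated_filter K_unc C_sat FF sV s0.
have dex (l : seq (seq nat)) : definable setT set0 (fun e' : V -> C =>
    exists x, forall s, List.In s l -> sat (PForm phi (node e' s)) x).
  exact: (@definable_consistent n m _ phi _ l (fun s i => (s, i))).
(* The tree property asks for an inconsistency number of at least 2, whereas the k of a pattern is
   arbitrary. *)
exists (maxn k 2), (node e); split; first exact: leq_maxr.
  move=> s; apply: k_inconsistent_leq (leq_maxl k 2) _ => t tk tl [x xP].
  apply: (eP _ (definable_not (dex [seq rcons s i | i <- t]))).
    exists (size s).+1 => e' [g1 _] [y yP].
    apply: (g1 s (ltnSn _) t tk tl); exists y => i it; apply: yP.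
    by apply/In_mem/map_f.
  by exists x => _ /In_mem/mapP[i it ->]; exact: xP.
move=> eta q /finite_set_list[l ql] qP.
have [N NP] : exists N, forall psi, List.In psi l -> exists2 j, (0 < j <= N)%N &
    psi = PForm phi (node e (mkseq eta j)).
  have {ql} : forall psi, List.In psi l -> [set PForm phi (node e (mkseq eta j)) |
      j in [set j | (1 <= j)%N]] psi by move=> psi /ql/qP.
  elim: l => [_|psi l IH lP]; first by exists 0.
  have [N NP] := IH (fun psi h => lP psi (or_intror h)).
  have [j /= j0 jpsi] := lP psi (or_introl erefl); exists (maxn N j) => chi [<-|/NP[i]].
    by exists j => //; rewrite j0 leq_maxr.
  move=> /andP[i0 iN]; exists i => //; rewrite i0 /=.
  exact: leq_trans iN (leq_maxl _ _).
have [|x xP] := eP _ (dex [seq mkseq eta j | j <- iota 1 N]).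
  exists N => e' [_ /(_ (mkseq eta N))]; rewrite size_mkseq => /(_ (leqnn _))[x xP].
  exists x => s /In_mem/mapP[j]; rewrite mem_iota add1n ltnS => jN ->.
  have := xP j jN; rewrite /mkseq -map_take take_iota.
  by have /andP[_ /minn_idPl->] := jN.
exists x => psi /ql/NP[j jN ->]; apply: xP; apply/In_mem/map_f.
by rewrite mem_iota add1n ltnS.
Qed.

Lemma simple_rank n (l : seq (@pattern L n)) : simple C ->
  exists N, ~ rank_ge [set d | List.In d l] N [set: n.-tuple C].
Proof.
move=> Csimple; elim: l => [|d l [N2 r2]]; first by exists 1 => -[].
have [N1 r1] := simple_rank1 d Csimple; exists (N1 + N2).
have -> : [set d' | List.In d' (d :: l)] = [set d] `|` [set d' | List.In d' l].
  by apply/seteqP; split=> d' [->|]; [left|right|left|right].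
by move=> /rank_ge_split[].
Qed.

End Simple.

(** * Forking *)

Section Forking.
Context {L : language} {C : structure L}.

Lemma conjugate_tp (A : set C) m (u v : m.-tuple C) :
  conjugate A u v -> tp u A = tp v A.
Proof.
move=> uv; apply/seteqP; split=> phi [phiA]; rewrite /tp /=.
  by rewrite (conjugate_sat uv phiA).
by rewrite -(conjugate_sat uv phiA).
Qed.

Lemma tp_sub (A B : set C) m (u v : m.-tuple C) :
  A `<=` B -> tp u B = tp v B -> tp u A = tp v A.
Proof.
move=> AB uv; have phiB (phi : pformula C m) : over A phi -> over B phi.
  by move=> phiA i /phiA/AB.
apply/seteqP; split=> phi [phiA phis]; split=> //.
    have : tp u B phi by split=> //; exact: phiB.
  by rewrite uv => -[].
have : tp v B phi by split=> //; exact: phiB.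
by rewrite -uv => -[].
Qed.

Lemma divides_sub (A B : set C) n (phi : pformula C n) :
  A `<=` B -> divides B phi -> divides A phi.
Proof.
by move=> AB [k [a [ta ka]]]; exists k, a; split=> // i; exact: tp_sub (ta i).
Qed.

(** Forking is attached to arbitrary sets of tuples, which makes the forking sets an ideal; its dual
    filter, joined with a type, yields nonforking extensions. *)
Definition forking_set (A : set C) n (X : set (n.-tuple C)) :=
  exists2 l, (forall phi, List.In phi l -> divides A phi) &
    forall x, X x -> exists2 phi, List.In phi l & sat phi x.

Lemma forking_set_sub (A B : set C) n (X Y : set (n.-tuple C)) :
  A `<=` B -> Y `<=` X -> forking_set B X -> forking_set A Y.
Proof.
move=> AB YX [l ld lX]; exists l => [phi /ld|x /YX/lX//].
exact: divides_sub.
Qed.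

Lemma forking_setU (A : set C) n (X Y : set (n.-tuple C)) :
  forking_set A X -> forking_set A Y -> forking_set A (X `|` Y).
Proof.
move=> [l1 ld1 lX] [l2 ld2 lY]; exists (l1 ++ l2) => [phi /List.in_app_iff[/ld1|/ld2]//|].
move=> x [/lX|/lY] [phi phil phis]; exists phi => //; apply/List.in_app_iff;
  by [left|right].
Qed.

Lemma forking_set_automorphism (A : set C) n (X Y : set (n.-tuple C)) g :
  automorphism g -> fixes A g -> (forall x, Y x -> X (map_tuple g x)) ->
  forking_set A X -> forking_set A Y.
Proof.
move=> ga gA YX [l ld lX]; have [h [ha gK hK]] := automorphism_inv ga.
exists [seq PForm (pform phi) (map_tuple h (par phi)) | phi <- l].
  move=> _ /List.in_map_iff[phi [<- /ld[k [a [ta ka]]]]].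
  exists k, a; split=> //= i; rewrite ta; apply: conjugate_tp.
  by exists h; split=> // x Ax; rewrite -[in LHS](gA x Ax) gK.
move=> x /YX/lX[phi phil]; case: phi phil => m phi b phil.
rewrite (sat_automorphism _ _ _ ha).
rewrite (_ : map_tuple h (map_tuple g x) = x); last first.
  by apply: eq_from_tnth => i; rewrite !tnth_map gK.
exists (PForm phi (map_tuple h b)) => //; apply/List.in_map_iff.
by exists (PForm phi b).
Qed.

Lemma forksP (A : set C) n (p : set (pformula C n)) :
  forks A p <-> exists2 q, (forall phi, List.In phi q -> p phi) &
    forking_set A [set x | forall phi, List.In phi q -> sat phi x].
Proof.
split=> [[Phi [/finite_set_list[l lP] Pd [Q [/finite_set_list[q qQ] Qp QP]]]]|].
  exists q => [phi /qQ/Qp//|]; exists l => [phi /lP/Pd//|x xq].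
  have [|phi /lP ? ?] := QP x; last by exists phi.
  by move=> phi /qQ/xq.
move=> [q qp [l ld lP]]; exists [set phi | List.In phi l]; split=> //.
  by apply/finite_set_list; exists l.
exists [set phi | List.In phi q]; split=> //.
  by apply/finite_set_list; exists q.
Qed.

Lemma over_all (B : set C) n (q : seq (pformula C n)) :
  (forall phi, List.In phi q -> over B phi) ->
  exists2 psi, over B psi &
    forall x, sat psi x <-> forall phi, List.In phi q -> sat phi x.
Proof.
move=> qB; have [psi psiB psiE] := sat_definable
  (definable_all (fun phi phiq => definable_sat (qB phi phiq))).
exists psi => // x; rewrite psiE.
by rewrite (_ : [tuple tnth x i | i < n] = x) //; apply: eq_from_tnth => i; rewrite tnth_mktuple.
Qed.

Lemma forks_tpP (A W : set C) n (x : n.-tuple C) :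
  forks A (tp x W) <-> exists psi, [/\ over W psi, sat psi x &
    forking_set A [set y | sat psi y]].
Proof.
rewrite forksP; split=> [[q qp fq]|[psi [psiW psix fpsi]]].
  have [psi psiW psiE] := over_all (fun phi phiq => (qp phi phiq).1).
  exists psi; split=> //; first by apply/psiE => phi /qp[].
  by apply: forking_set_sub fq => // y /psiE.
exists [:: psi] => [phi [<-|//]//|].
by apply: forking_set_sub fpsi => // y; apply; left.
Qed.

Lemma forks_tp_sub (A A' W W' : set C) n (x : n.-tuple C) :
  A' `<=` A -> W `<=` W' -> forks A (tp x W) -> forks A' (tp x W').
Proof.
move=> AA WW /forks_tpP[psi [psiW psix fpsi]]; apply/forks_tpP; exists psi.
by split=> //; [move=> i /psiW/WW|apply: forking_set_sub fpsi].
Qed.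

Context {K : Type}.
Hypothesis K_unc : ~ countable [set: K].
Hypothesis C_sat : saturated K C.
Hypothesis C_hom : strongly_homogeneous K C.

Lemma small_range m (u : m.-tuple C) : small K (range (tnth u)).
Proof. by apply/small_image/small_countable => //; exact: countableP. Qed.

(** Since theta is invariant over A, the automorphisms that carry phi to its conjugates carry the
    rank of theta and phi to every branch. *)
Lemma rank_ge_kdivides (A : set C) n k (phi : pformula C n) D N theta :
  kdivides A k phi ->
  (forall g, automorphism g -> fixes A g ->
    forall x, theta x -> theta (map_tuple g x)) ->
  D (pattern_of k phi) -> rank_ge D N (theta `&` [set x | sat phi x]) ->
  rank_ge D N.+1 theta.
Proof.
move=> [a [ca ka]] tA Dphi rphi; exists (pattern_of k phi) => //; exists a.
split=> // i; have [g [ga gA ga']] := ca i.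
apply: (rank_ge_automorphism ga _ rphi) => x [tx sx]; split; first exact: (tA g ga gA).
by rewrite /= /instance -ga' /= -sat_automorphism //; case: (phi) sx.
Qed.

(** If psi over D were covered by formulas dividing over D, one of them would keep any rank N of
    psi, and dividing would raise the rank of the D-invariant psi to N + 1. All ranks would be
    reached, against simplicity. *)
Lemma existence (D : set C) n (c : n.-tuple C) :
  simple C -> small K D -> ~ forks D (tp c D).
Proof.
move=> Csimple sD /forks_tpP[psi [psiD psic [l ld lpsi]]].
have [kk kkP] : {kk : pformula C n -> nat & forall phi, List.In phi l ->
    kdivides D (kk phi) phi}.
  apply: (@choice _ _ (fun phi k => List.In phi l -> kdivides D k phi)) => phi.
  have [/ld|nl] := pselect (List.In phi l); last by exists 0 => ?; case: nl.
  by move=> /(dividesP C_hom (small_setU K_unc sD (@small_range _ _)))[k kd]; exists k.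
have [N] := simple_rank K_unc C_sat [seq pattern_of (kk phi) phi | phi <- l] Csimple.
apply; apply: (@rank_ge_sub _ _ _ _ _ [set x | sat psi x]) => //.
elim: N => [|N IH]; first by exists c.
have [phi phil rphi] := rank_ge_cover lpsi IH.
apply: rank_ge_kdivides (kkP phi phil) _ _ rphi.
  move=> g ga gD x; apply: (conjugate_sat _ psiD).1; exists g; split=> //.
by apply/List.in_map_iff; exists phi.
Qed.

Lemma extension (A B W : set C) n (p : set (pformula C n)) :
  small K W -> B `<=` W -> p `<=` over B -> ~ forks A p ->
  exists2 c, realizes c p & ~ forks A (tp c W).
Proof.
move=> sW BW pB nfp.
(* Generated by p and the complements of forking sets; it is proper exactly because p does not
   fork. *)
pose F := [set P : set (n.-tuple C) | exists q Y, [/\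
  forall phi, List.In phi q -> p phi, forking_set A Y &
  forall x, (forall phi, List.In phi q -> sat phi x) -> ~ Y x -> P x]].
have f0 : forking_set A (set0 : set (n.-tuple C)) by exists [::].
have FF : ProperFilter F.
  split=> [[q [Y [qp fY qY]]]|].
    apply: nfp; apply/forksP; exists q => //; apply: forking_set_sub fY => // x xq.
    exact: (contrapT (qY x xq)).
  split=> [|P Q [q1 [Y1 [qp1 fY1 P1]]] [q2 [Y2 [qp2 fY2 P2]]]|].
  - by exists [::], set0.
  - exists (q1 ++ q2), (Y1 `|` Y2); split; last 1 first.
    + move=> x xq /not_orP[nY1 nY2]; split; [apply: P1|apply: P2] => // phi phiq;
        apply: xq; apply/List.in_app_iff; by [left|right].
    + by move=> phi /List.in_app_iff[/qp1|/qp2].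
    + exact: forking_setU.
  - move=> P Q PQ [q [Y [qp fY qY]]]; exists q, Y; split=> // x xq nY.
    exact/PQ/qY.
have [c cP] := saturated_filter_tuple K_unc C_sat FF sW.
exists c => [phi pphi|/forks_tpP[psi [psiW psic fpsi]]].
  apply: cP => [i /(pB _ pphi)/BW//|].
  by exists [:: phi], set0; split=> // [_ [<-|//]|x xq _]; last by apply: xq; left.
apply: (cP (pneg psi)) => //.
by exists [::], [set y | sat psi y].
Qed.

(* Over every base between A and A U W, dividing by a formula over A U W is not
   destroyed by adding U to the base. *)
Definition indep (A U W : set C) := forall A', A `<=` A' -> A' `<=` A `|` W ->
  forall n k (phi : pformula C n), over (A `|` W) phi ->
  kdivides A' k phi -> kdivides (A' `|` U) k phi.

(** The second hypothesis is applied over A' U rather than A U; for this the definition quantifies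
    over all intermediate bases. *)
Lemma indep_trans (A U V W : set C) :
  indep A U W -> indep (A `|` U) V W -> indep A (U `|` V) W.
Proof.
move=> iU iV A' AA' A'W n k phi phiW /(iU A' AA' A'W _ _ _ phiW) kU.
rewrite setUA; apply: (iV (A' `|` U)) kU.
- by apply: setSU.
- by move=> x [/A'W[]|]; [left; left|right|left; right].
- by move=> i /phiW[]; [left; left|right].
Qed.

Lemma indep_base (A U V W : set C) :
  indep A V (W `|` U) -> indep (A `|` U) V W.
Proof.
move=> iV A' AUA' A'W n k phi phiW; apply: iV.
- by move=> x Ax; apply: AUA'; left.
- by move=> x /A'W[[]|]; [left|right; right|right; left].
- by move=> i /phiW[[]|]; [left|right; right|right; left].
Qed.

Lemma indep_sub (A U W W' : set C) : W' `<=` W -> indep A U W -> indep A U W'.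
Proof.
move=> WW iU A' AA' A'W n k phi phiW; apply: iU => //.
  by move=> x /A'W[|/WW]; [left|right].
by move=> i /phiW[|/WW]; [left|right].
Qed.

(* Let a = (a_j) witness that phi k-divides over A'. As no formula of
   tp(u/A U W) divides, saturation gives u' and a k-inconsistent sequence a' with
   (u', a'_j) conjugate to (u, b) over A' for every j; moving u' to u turns a'
   into a witness over A' U u. *)
Lemma nonforking_indep (A W : set C) m (u : m.-tuple C) :
  small K A -> small K W -> ~ forks A (tp u (A `|` W)) ->
  indep A (range (tnth u)) W.
Proof.
move=> sA sW nfu A' AA' A'W n k [l phi b] /= phiW [a [ca ka]]; simpl in *.
have sA' : small K A' by apply: small_sub A'W _; exact: small_setU.
have [c0] := carrier_inhabited C.
(* Otherwise psi(x, b) would k'-divide over A along a, although it belongs to tp(u/A W). *)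
have consistent_along (psi : pformula C (m + l)) k' : over A' psi ->
    sat psi [tuple of u ++ b] -> exists s (x : m.-tuple C),
      [/\ size s = k', sorted ltn s &
      forall i, i \in s -> sat psi [tuple of x ++ a i]].
  case: psi => r psi d dA' psib; apply: contrapT => ns; apply: nfu.
  pose psi' := rename psi (cast_ord (esym (addnA m l r))).
  have psiE (x : m.-tuple C) (y : l.-tuple C) : sat (PForm psi' [tuple of y ++ d]) x <->
      sat (PForm psi d) [tuple of x ++ y].
    rewrite /sat /= eval_rename (_ : [tuple _ | _ < _] =
      [tuple of [tuple of x ++ y] ++ d]) //.
    by apply: eq_from_tnth => i; rewrite tnth_mktuple !(tnth_nth c0) /= catA.
  have bdW (i : 'I_(l + r)) : (A `|` W) (tnth [tuple of b ++ d] i).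
    case: (fintype.splitP i) => j ij.
      rewrite (_ : i = lshift _ j) ?tnth_lshift; last exact: val_inj.
      by apply: phiW; exists j.
    rewrite (_ : i = rshift _ j) ?tnth_rshift; last exact: val_inj.
    by apply: A'W; apply: dA'; exists j.
  apply/forks_tpP; exists (PForm psi' [tuple of b ++ d]); split=> /=.
  - by move=> _ [i _ <-]; exact: bdW.
  - exact/psiE.
  exists [:: PForm psi' [tuple of b ++ d]] => [_ [<-|//]|x xs]; last first.
    by exists (PForm psi' [tuple of b ++ d]) => //; left.
  exists k', (fun i => [tuple of a i ++ d]); split=> [i|s sk ss [x xs]].
    have [g [ga gA' <-]] := ca i; apply/esym/conjugate_tp; exists g; split=> //.
      by move=> x /AA'/gA'.
    apply: val_inj; rewrite /= map_cat; congr cat.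
    apply: (congr1 val (_ : map_tuple g d = d)); apply: eq_from_tnth => j.
    by rewrite tnth_map; apply/gA'/dA'; exists j.
  by apply: ns; exists s, x; split=> // j /xs/psiE.
pose V := ('I_n + ('I_m + nat * 'I_l))%type.
pose aj (e : V -> C) j := [tuple e (inr (inr (j, i))) | i < l].
pose uj (e : V -> C) := [tuple e (inr (inl i)) | i < m].
(* A point e codes u' and the sequence a'. The conditions are finite: the first k' terms of a' form
   a subsequence of a, which keeps the k-inconsistency, and each of them satisfies psi together with
   u'. *)
pose F := [set P : set (V -> C) | exists k' psi, [/\ over A' psi,
  sat psi [tuple of u ++ b] & forall e, (exists s, [/\ size s = k', sorted ltn s &
    forall j, (j < k')%N -> aj e j = a (nth 0 s j) /\
      sat psi [tuple of uj e ++ aj e j]]) -> P e]].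
pose true_psi : pformula C (m + l) := PForm (FNot FFalse) [tuple].
have true_over : over A' true_psi by move=> x [[]].
have true_sat x : sat true_psi x by [].
have FF : ProperFilter F.
  split=> [[k' [psi [psiA' psib H]]]|].
    have [s [x [ss sl sx]]] := consistent_along psi k' psiA' psib.
    pose e (v : V) := match v with inl _ => c0 | inr (inl i) => tnth x i
      | inr (inr (j, i)) => tnth (a (nth 0 s j)) i end.
    apply: (H e); exists s; split=> // j jk.
    have -> : aj e j = a (nth 0 s j).
      by apply: eq_from_tnth => i; rewrite tnth_mktuple.
    have -> : uj e = x by apply: eq_from_tnth => i; rewrite tnth_mktuple.
    by split=> //; apply: sx; rewrite mem_nth // ss.
  split=> [|P Q [k1 [psi1 [o1 s1 P1]]] [k2 [psi2 [o2 s2 P2]]]|P Q PQ [k' [psi [o s H]]]].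
  - by exists 0, true_psi.
  - have [psi oo psiE] : exists2 psi, over A' psi & forall x, sat psi x <->
        forall phi, List.In phi [:: psi1; psi2] -> sat phi x.
      by apply: over_all => chi [<-|[<-|]].
    exists (maxn k1 k2), psi; split=> //; first by apply/psiE => chi [<-|[<-|]].
    move=> e [s [ss sl sj]]; split; [apply: P1; exists (take k1 s)|
        apply: P2; exists (take k2 s)]; split; rewrite ?take_sorted //.
    + by rewrite size_takel // ss leq_maxl.
    + move=> j jk; rewrite nth_take //.
      have [|-> /psiE sp] := sj j; first exact: leq_trans jk (leq_maxl _ _).
      by split=> //; apply: sp; left.
    + by rewrite size_takel // ss leq_maxr.
    + move=> j jk; rewrite nth_take //.
      have [|-> /psiE sp] := sj j; first exact: leq_trans jk (leq_maxr _ _).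
      by split=> //; apply: sp; right; left.
  - by exists k', psi; split=> // e /H/PQ.
have sV : small K [set: V] by apply: small_countable => //; exact: countableP.
have [e eP] := saturated_filter K_unc C_sat FF sV sA'.
have conj_e j : conjugate A' [tuple of u ++ b] [tuple of uj e ++ aj e j].
  apply: tp_conjugate C_hom _ _.
    by apply: small_setU => //; exact: small_range.
  move=> psi psiA' psib.
  pose f (i : 'I_(m + l)) : V + C := match fintype.split i with
    inl i => inl (inr (inl i)) | inr i => inl (inr (inr (j, i))) end.
  have fE e' : [tuple value e' (f i) | i < m + l] = [tuple of uj e' ++ aj e' j].
    apply: eq_from_tnth => i; rewrite tnth_mktuple /f.
    by case: (splitP i) => i' ii; [rewrite (_ : i = lshift _ i')|rewrite (_ : i = rshift _ i')];
      rewrite ?tnth_lshift ?tnth_rshift ?tnth_mktuple //; apply: val_inj.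
  have fw i : [set: 'I_(m + l)] i -> within setT A' (f i).
    by rewrite /f; case: fintype.split.
  have := eP _ (definable_subst fw (definable_sat psiA')); rewrite fE; apply.
  exists j.+1, psi; split=> // e' [s [_ _ /(_ j (ltnSn _))[_]]].
  by rewrite /= fE.
have ke : k_inconsistent k (fun j => PForm phi (aj e j)).
  move=> s sk ss [x xs].
  have dE := @definable_consistent _ C n l _ phi _ s (fun j i => inr (j, i) : 'I_m + nat * 'I_l).
  have dE' := definable_sub (fun _ h => h) (@sub0set _ A') (definable_not dE).
  have [] := eP _ dE'; last by exists x => j /In_mem/xs.
  (* An initial segment long enough to contain all indices in s. *)
  exists (\max_(j <- s) j).+1, true_psi; split=> // e' [t [tk tl tj]] [y ys].
  have lts j : j \in s -> (j < (\max_(j <- s) j).+1)%N.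
    by move=> js; rewrite ltnS; apply: leq_bigmax_seq.
  apply: (ka [seq nth 0 t j | j <- s]); first by rewrite size_map.
    rewrite sorted_map; apply: sub_in_sorted ss; last exact: allss.
    move=> i j /lts il /lts jl /= ij; rewrite -tk in il jl.
    by apply: (sorted_ltn_nth ltn_trans 0 tl).
  by exists y => _ /mapP[j js ->]; rewrite -(tj j (lts _ js)).1; exact/ys/In_mem.
(* The inverse [h0] of [g0] moves u' back to u, so that [h0 \o gj] fixes u and sends b to the j-th
   term of the new witness. *)
have [g0 [g0a g0A' g0u]] := conj_e 0.
have [h0 [h0a gK hK]] := automorphism_inv g0a.
have split_cat (g : C -> C) (x : m.-tuple C) (y : l.-tuple C) :
    map_tuple g [tuple of u ++ b] = [tuple of x ++ y] ->
    map_tuple g u = x /\ map_tuple g b = y.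
  move=> /(congr1 val)/=; rewrite map_cat => e_cat; split; apply: val_inj.
    by have := congr1 (take m) e_cat; rewrite !take_size_cat ?size_map ?size_tuple.
  by have := congr1 (drop m) e_cat; rewrite !drop_size_cat ?size_map ?size_tuple.
exists (fun j => map_tuple h0 (aj e j)); split=> [j|]; last first.
  exact: k_inconsistent_automorphism.
have [gj [gja gjA' /split_cat[gju gjb]]] := conj_e j.
have [g0u' _] := split_cat _ _ _ g0u.
exists (h0 \o gj); split; first exact: automorphism_comp.
  move=> x [A'x|[i _ <-]] /=; first by rewrite gjA' // -[in LHS](g0A' x) // gK.
  have := congr1 (fun t => tnth t i) gju; rewrite -g0u' !tnth_map => ->.
  by rewrite gK.
by rewrite -gjb; apply: eq_from_tnth => i; rewrite !tnth_map.
Qed.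

End Forking.

(** * Symmetry *)

(** Dependent choice in which every choice may refer to the list of all previous ones. *)
Lemma history_choice T (R : seq T -> T -> Prop) : (forall s, exists t, R s t) ->
  exists h : nat -> T, forall i, exists2 s, R s (h i) &
    forall j, (j < i)%N -> List.In (h j) s.
Proof.
move=> /choice[f fR]; pose past := fix past i := if i is i'.+1 then f (past i') :: past i' else [::].
exists (fun i => f (past i)) => i; exists (past i) => // j.
elim: i => [//|i IH] /=; rewrite ltnS leq_eqVlt => /orP[/eqP->|/IH]; by [left|right].
Qed.

Lemma In_tnth T n (t : n.-tuple T) x : List.In x t <-> range (tnth t) x.
Proof.
elim: n t x => [|n IH] t x; first by rewrite tuple0; split=> // -[[]].
case/tupleP: t => y t; rewrite (_ : List.In x _ = (y = x \/ List.In x t)) //.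
split=> [[yx|xt]|[i _ <-]].
- by exists ord0; rewrite // tnth0.
- by have [i _ <-] := (IH t x).1 xt; exists (lift ord0 i); rewrite // tnthS.
- case: (unliftP ord0 i) => [j|] ->; [right|by left; rewrite tnth0].
  by rewrite tnthS; apply: (IH t _).2; exists j.
Qed.

Lemma image_range_tnth T T' n (f : T -> T') (t : n.-tuple T) :
  f @` range (tnth t) = range (tnth (map_tuple f t)).
Proof.
apply/seteqP; split=> [_ [_ [i _ <-] <-]|_ [i _ <-]].
  by exists i; rewrite // tnth_map.
by exists (tnth t i); [exists i|rewrite tnth_map].
Qed.

Section Symmetry.
Context {K : Type} {L : language} {C : structure L}.
Hypothesis K_unc : ~ countable [set: K].
Hypothesis C_sat : saturated K C.
Hypothesis C_hom : strongly_homogeneous K C.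
Hypothesis C_simple : simple C.

Lemma fixes_tuple (A : set C) g m (a : m.-tuple C) :
  fixes A g -> range (tnth a) `<=` A -> map_tuple g a = a.
Proof.
by move=> gA aA; apply: eq_from_tnth => i; rewrite tnth_map; apply/gA/aA; exists i.
Qed.

Lemma kdivides_automorphism (A : set C) n k (phi : pformula C n) g :
  automorphism g -> fixes A g -> kdivides A k phi ->
  kdivides A k (PForm (pform phi) (map_tuple g (par phi))).
Proof.
move=> ga gA [a [ca ka]]; exists a; split=> //= i.
have [h [ha gK hK]] := automorphism_inv ga; have [f [fa fA <-]] := ca i.
exists (f \o h); split; first exact: automorphism_comp.
  by move=> x Ax /=; rewrite -[in h x](gA x Ax) gK fA.
by apply: eq_from_tnth => j; rewrite !tnth_map /= gK.
Qed.

Lemma tp_realizes_conjugate (A W : set C) m (u v : m.-tuple C) :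
  small K W -> A `<=` W -> realizes v (tp u W) -> conjugate A u v.
Proof.
move=> sW AW uv; apply: conjugate_sub AW _; apply: tp_conjugate C_hom _ _.
  by apply: small_setU => //; exact: small_range.
by move=> phi phiW phiu; apply: uv.
Qed.

Lemma independent_conjugate (A W : set C) m r s (u : m.-tuple C)
    (w : r.-tuple C) (c : s.-tuple C) :
  small K A -> small K W -> ~ forks A (tp u (A `|` range (tnth w))) ->
  exists h, [/\ automorphism h, fixes A h,
    indep A (h @` (range (tnth u) `|` range (tnth c))) W &
    forall n (psi : formula L (r + n)) b, range (tnth b) `<=` A `|` range (tnth u) ->
      sat (PForm psi b) w -> sat (PForm psi (map_tuple h b)) w].
Proof.
move=> sA sW nfu; set Aw := A `|` range (tnth w).
have sAw : small K Aw by apply: small_setU => //; exact: small_range.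
have [u' u'u nfu'] : exists2 u', realizes u' (tp u Aw) & ~ forks A (tp u' (Aw `|` W)).
  apply: (@extension _ _ _ K_unc C_sat A Aw) => //; first exact: small_setU.
  by move=> phi [].
have [g [ga gAw gu]] := tp_realizes_conjugate sAw (fun _ h => h) u'u.
set Au := A `|` range (tnth u').
have sAu : small K Au by apply: small_setU => //; exact: small_range.
have [c' c'c nfc'] : exists2 c', realizes c' (tp (map_tuple g c) Au) &
    ~ forks Au (tp c' (Au `|` W)).
  apply: (@extension _ _ _ K_unc C_sat Au Au) => //; first exact: small_setU.
    by move=> phi [].
  exact: (existence K_unc C_sat C_hom).
have [g' [g'a g'Au g'c]] := tp_realizes_conjugate sAu (fun _ h => h) c'c.
have g'u : map_tuple g' u' = u' by apply: fixes_tuple g'Au _ => x; right.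
exists (g' \o g); split; first exact: automorphism_comp.
- by move=> x Ax /=; rewrite gAw; [apply: g'Au; left|left].
- have iu : indep A (range (tnth u')) W.
    apply: (nonforking_indep K_unc C_sat C_hom) => // fk; apply: nfu'; apply: forks_tp_sub fk => //.
    by move=> x []; [left; left|right].
  have ic : indep Au (range (tnth c')) W by exact: (nonforking_indep K_unc C_sat C_hom).
  rewrite (_ : _ @` _ = range (tnth u') `|` range (tnth c')).
    exact: indep_trans iu ic.
  have comp q (t : q.-tuple C) : map_tuple (g' \o g) t = map_tuple g' (map_tuple g t).
    by apply: eq_from_tnth => i; rewrite !tnth_map.
  by rewrite image_setU !image_range_tnth !comp gu g'u g'c.
move=> n psi b bA; rewrite (sat_automorphism _ _ _ ga).
rewrite (fixes_tuple gAw (_ : range (tnth w) `<=` Aw)); last by move=> x; right.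
rewrite (_ : map_tuple (g' \o g) b = map_tuple g b) //.
apply: eq_from_tnth => i; rewrite !tnth_map /=; apply: g'Au.
have [Ab|[j _ <-]] := bA (tnth b i) (ex_intro2 _ _ i Logic.I erefl).
  by left; rewrite gAw //; left.
by right; exists j => //; rewrite -gu tnth_map.
Qed.

(** The later sets are gathered one at a time: S N is independent from S i together with the sets
    already gathered, and [indep_base] moves the latter into the base, where [indep_trans] needs
    them. *)
Lemma indep_after (A : set C) (S : nat -> set C) :
  (forall j, indep A (S j) (\bigcup_(i in [set i | (i < j)%N]) S i)) ->
  forall N i, indep A (\bigcup_(j in [set j | (i < j < N)%N]) S j) (S i).
Proof.
move=> iS N i; elim: N => [|N IH].
  rewrite (_ : bigcup _ _ = set0); last first.
    by apply/seteqP; split=> // x [j /=]; rewrite ltn0 andbF.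
  by move=> A' _ _ n k phi _; rewrite setU0.
have [iN|Ni] := ltnP i N; last first.
  rewrite (_ : bigcup _ _ = bigcup [set j | (i < j < N)%N] S) //.
  apply/seteqP; split=> x [j /= /andP[ij jN] Sx]; exists j => //=.
    by move: jN; rewrite ltnS => /(leq_trans ij); rewrite ltnNge Ni.
  by rewrite ij ltnW.
rewrite (_ : bigcup _ _ = bigcup [set j | (i < j < N)%N] S `|` S N).
  apply: indep_trans IH _; apply: indep_base; apply: indep_sub (iS N).
  move=> x [Sx|[j /andP[_ jN] Sx]]; [by exists i|by exists j].
apply/seteqP; split=> x.
  move=> [j /= /andP[ij]]; rewrite ltnS leq_eqVlt => /orP[/eqP->|jN] Sx; first by right.
  by left; exists j => //=; rewrite ij.
by move=> [[j /= /andP[ij jN] Sx]|Sx]; [exists j|exists N] => //=;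
  rewrite ?ij ?iN /= ltnS // ltnW.
Qed.

(* If tp(w/Au) forks through formulas phi with parameters c, take conjugates
   h_i(u, c) over A, each independent from the previous ones and keeping w
   inside the forking set. Then some phi(., h_i c) holds at w for each i < N, and
   read backwards these formulas form a dividing chain of length N. *)
Lemma symmetry (A : set C) m r (u : m.-tuple C) (w : r.-tuple C) :
  small K A -> ~ forks A (tp u (A `|` range (tnth w))) ->
  ~ forks A (tp w (A `|` range (tnth u))).
Proof.
move=> sA nfu /forks_tpP[[t psi b] [/= bA psiw [l ld lpsi]]].
have [kk kkP] : {kk : pformula C r -> nat & forall phi, List.In phi l ->
    kdivides A (kk phi) phi}.
  apply: (@choice _ _ (fun phi k => List.In phi l -> kdivides A k phi)) => phi.
  have [/ld|nl] := pselect (List.In phi l); last by exists 0 => ?; case: nl.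
  move=> /(dividesP C_hom (small_setU K_unc sA (small_range K_unc (u := _))))[k kd].
  by exists k.
(* One tuple holds the parameters of all disjuncts, so that a single conjugation moves the whole
   forking disjunction. *)
pose c := in_tuple (flatten [seq tval (par phi) | phi <- l]).
have cP phi : List.In phi l -> range (tnth (par phi)) `<=` range (tnth c).
  move=> phil x /In_tnth xphi; apply/In_tnth; rewrite /c /=.
  elim: l phil {ld lpsi kkP c} => [//|chi l IH] /=.
  by move=> [->|/IH ?]; apply/List.in_app_iff; [left|right].
pose S0 := range (tnth u) `|` range (tnth c).
pose past := foldr (fun (h : C -> C) W => h @` S0 `|` W) (set0 : set C).
have pastP h hs : List.In h hs -> h @` S0 `<=` past hs.
  by elim: hs => [//|h' hs IH] /= [->|/IH hS] x; [left|right; exact: hS].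
have sS0 : small K S0 by apply: small_setU => //; exact: small_range.
have spast hs : small K (past hs).
  elim: hs => [|h hs IH] /=; first by apply: small_countable => //; exact: countable0.
  by apply: small_setU => //; exact: small_image.
have [h hP] := history_choice (fun hs => independent_conjugate c sA (spast hs) nfu).
have ha i : automorphism (h i) by have [s []] := hP i.
have hA i : fixes A (h i) by have [s []] := hP i.
have hw i : sat (PForm psi (map_tuple (h i) b)) w.
  by have [s [_ _ _ hpsi] _] := hP i; exact: hpsi.
pose S i := h i @` S0.
have iS j : indep A (S j) (\bigcup_(i in [set i | (i < j)%N]) S i).
  have [s [_ _ iSj _] sj] := hP j; apply: indep_sub iSj.
  by move=> x [i /= /sj/pastP hS Sx]; exact: hS.
have iafter := indep_after iS.
pose image_of i (phi : pformula C r) := PForm (pform phi) (map_tuple (h i) (par phi)).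
(* The disjunct true at w may vary with i; hence the rank must allow a finite set of patterns. *)
have [f fP] : {f : nat -> pformula C r & forall i, List.In (f i) l /\ sat (image_of i (f i)) w}.
  apply: (@choice _ _ (fun i phi => List.In phi l /\ sat (image_of i phi) w)) => i.
  have [g [ga gK hK]] := automorphism_inv (ha i).
  have wE : map_tuple (h i) (map_tuple g w) = w.
    by apply: eq_from_tnth => j; rewrite !tnth_map hK.
  have [|phi phil phis] := lpsi (map_tuple g w).
    by rewrite /= (sat_automorphism _ _ _ (ha i)) wE.
  exists phi; split=> //; case: phi {phil} phis => k phi d.
  by rewrite (sat_automorphism _ _ _ (ha i)) wE.
pose D := [set d | List.In d [seq pattern_of (kk phi) phi | phi <- l]].
have [N] := simple_rank K_unc C_sat [seq pattern_of (kk phi) phi | phi <- l] C_simple.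
(* The chain is read from its end: [theta 0] imposes all N formulas and is nonempty because of w.
   Dropping the formula number i, which divides over A and the later S j, gains one rank, and
   [theta N] is the whole space. *)
pose theta i := [set z | forall j, (i <= j < N)%N -> sat (image_of j (f j)) z].
suff rN i : (i <= N)%N -> rank_ge D i (theta i).
  by apply; apply: rank_ge_sub (rN N (leqnn N)).
elim: i => [_|i IH iN].
  by exists w => j _; exact: (fP j).2.
have [fil fiw] := fP i.
have over_image j : range (tnth (par (image_of j (f j)))) `<=` S j.
  move=> _ [t' _ <-] /=; rewrite tnth_map; exists (tnth (par (f j)) t') => //.
  by right; apply: (cP (f j) (fP j).1); exists t'.
have kd : kdivides (A `|` \bigcup_(j in [set j | (i < j < N)%N]) S j) (kk (f i))
    (image_of i (f i)).
  apply: (iafter N i A (fun _ h => h) (fun _ h => or_introl h)).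
    by move=> x /over_image; right.
  by apply: kdivides_automorphism (hA i) _ => //; exact: kkP.
apply: (rank_ge_kdivides kd).
- move=> g ga gfix z zi j ijN.
  rewrite /image_of -(fixes_tuple gfix (a := map_tuple (h j) (par (f j)))).
    by rewrite -sat_automorphism //; exact: zi.
  by move=> x /(over_image j) Sx; right; exists j.
- by apply/List.in_map_iff; exists (f i).
apply: rank_ge_sub (IH (ltnW iN)) => z zi; split.
  by move=> j /andP[ij jN]; apply: zi; rewrite jN ltnW.
by apply: zi; rewrite leqnn iN.
Qed.

End Symmetry.

(** * Extraction of indiscernibles *)

Section IteratedUltrafilter.
Context {U : set_system nat} {UU : UltraFilter U}.
Hypothesis U_inf : \oo `<=` U.

(* The quantifier 'for U-most i', iterated k times; it takes the place of
   Ramsey's theorem in the extraction of indiscernibles. *)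
Fixpoint almost k (Q : seq nat -> Prop) : Prop :=
  if k is k'.+1 then U [set i | almost k' (fun s => Q (i :: s))] else Q [::].

Lemma almost_sub k (Q R : seq nat -> Prop) :
  (forall s, size s = k -> Q s -> R s) -> almost k Q -> almost k R.
Proof.
elim: k Q R => [|k IH] Q R QR /=; first exact: QR.
by apply: filterS => i; apply: IH => s sk; apply: QR; rewrite /= sk.
Qed.

Lemma almost_and k (Q R : seq nat -> Prop) :
  almost k Q -> almost k R -> almost k (fun s => Q s /\ R s).
Proof.
elim: k Q R => [//|k IH] Q R /= Qk Rk.
by apply: filterS (filterI Qk Rk) => i [] /IH; apply.
Qed.

Lemma almost_not k (Q : seq nat -> Prop) :
  almost k Q \/ almost k (fun s => ~ Q s).
Proof.
elim: k Q => [|k IH] Q /=; first by case: (pselect (Q [::])); [left|right].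
have [|nQ] := in_ultra_setVsetC [set i | almost k (fun s => Q (i :: s))] UU.
  by left.
by right; apply: filterS nQ => i; have [|] := IH (fun s => Q (i :: s)).
Qed.

Lemma almost_ex k (Q : seq nat -> Prop) :
  almost k Q -> exists2 s, size s = k & Q s.
Proof.
elim: k Q => [|k IH] Q /=; first by exists [::].
by move=> /filter_ex[i /IH[s sk Qs]]; exists (i :: s); rewrite //= sk.
Qed.

(** The places masked out are dummy quantifiers. *)
Lemma almost_mask (m : bitseq) (Q : seq nat -> Prop) :
  almost (count id m) Q -> almost (size m) (fun s => Q (mask m s)).
Proof.
elim: m Q => [|[] m IH] Q //=; first by apply: filterS => i; exact: IH.
by rewrite add0n => /IH Qm; apply: filterS filterT => i _.
Qed.

Lemma almost_sorted k : almost k (fun s => sorted ltn s).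
Proof.
have path_b b : almost k (fun s => path ltn b s).
  elim: k b => [//|k IH] b /=.
  have : U [set i | (b.+1 <= i)%N] by apply: U_inf; exists b.+1.
  by apply: filterS => i bi; apply: almost_sub (IH i) => s _ ->; rewrite andbT.
by apply: almost_sub (path_b 0) => s _; exact: path_sorted.
Qed.

Context {d : Order.disp_t} {I : orderType d}.

(** The iterated product of U along I, on cylinders over finite subsets of I. Listing f in
    increasing order makes the order of the quantifiers agree with that of I. *)
Definition increasing_filter : set_system (I -> nat) :=
  [set Q | exists f : seq I, sorted <%O f /\
    almost (size f) (fun s => forall sigma, map sigma f = s -> Q sigma)].

(** Brings two members of the filter to a common finite support, so that they can be intersected. *)
Lemma increasing_filter_widen (f g : seq I) (Q : (I -> nat) -> Prop) :
  sorted <%O f -> sorted <%O g -> {subset f <= g} ->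
  almost (size f) (fun s => forall sigma, map sigma f = s -> Q sigma) ->
  almost (size g) (fun s => forall sigma, map sigma g = s -> Q sigma).
Proof.
move=> fs gs fg; have fE : f = mask [seq x \in f | x <- g] g.
  rewrite -filter_mask; apply: lt_sorted_eq => //; first exact: lt_sorted_filter.
  by move=> x; rewrite mem_filter; case: (boolP (x \in f)) => // /fg ->.
rewrite {1}fE size_mask ?size_map // => /almost_mask; rewrite size_map.
apply: almost_sub => s _ H sigma sg; apply: H.
by rewrite -sg -map_mask -fE.
Qed.

Lemma sort_undup_lt_sorted (f : seq I) : sorted <%O (sort <=%O (undup f)).
Proof. by rewrite sort_lt_sorted undup_uniq. Qed.

Lemma increasing_filter_proper : ProperFilter increasing_filter.
Proof.
split=> [[f [fs /almost_ex[s sf]]]|].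
  case: f fs sf => [|i0 f] fs sf H; first by apply: (H (fun=> 0)); case: (s) sf.
  apply: (H (fun i => nth 0 s (index i (i0 :: f)))).
  apply: (@eq_from_nth _ 0); rewrite size_map // => j jf.
  by rewrite (nth_map i0) // index_uniq // lt_sorted_uniq.
split=> [|P Q [f [fs Pf]] [g [gs Qg]]|P Q PQ [f [fs Pf]]].
- by exists [::].
- exists (sort <=%O (undup (f ++ g))); split; first exact: sort_undup_lt_sorted.
  have ss := sort_undup_lt_sorted (f ++ g).
  have fP := increasing_filter_widen fs ss _ Pf.
  have gQ := increasing_filter_widen gs ss _ Qg.
  apply: almost_sub (almost_and (fP _) (gQ _)).
  + by move=> s _ [Ps Qs] sigma sE; split; [exact: Ps|exact: Qs].
  + by move=> x xf; rewrite mem_sort mem_undup mem_cat xf.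
  + by move=> x xg; rewrite mem_sort mem_undup mem_cat xg orbT.
- by exists f; split=> //; apply: almost_sub Pf => s _ H sigma /H/PQ.
Qed.

(** U contains the cofinite sets, so U-most choices of the next index exceed the previous one. *)
Lemma increasing_filter_mono (f : seq I) :
  increasing_filter [set sigma | {in f &, {homo sigma : i j / (i < j)%O >-> (i < j)%N}}].
Proof.
pose g := sort <=%O (undup f); have gs := sort_undup_lt_sorted f.
exists g; split=> //; apply: almost_sub (almost_sorted (size g)) => s sg ss sigma sE.
move=> i j fi fj ij; have gi : i \in g by rewrite mem_sort mem_undup.
have gj : j \in g by rewrite mem_sort mem_undup.
have sigmaE x : x \in g -> sigma x = nth 0 s (index x g).
  by move=> gx; rewrite -sE (nth_map x) ?index_mem // nth_index.
rewrite !sigmaE //.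
apply: (sorted_ltn_nth ltn_trans 0 ss); rewrite ?inE ?sg ?index_mem //.
rewrite ltnNge; apply/negP; rewrite leq_eqVlt => /orP[/eqP e|lt].
  by move: ij; rewrite -(nth_index i gi) -e nth_index // ltxx.
have := sorted_ltn_nth lt_trans i gs; move=> /(_ (index j g) (index i g)).
rewrite !inE !index_mem gi gj !nth_index // => /(_ isT isT lt) ji.
by move: (lt_trans ij ji); rewrite ltxx.
Qed.

End IteratedUltrafilter.

(** The decomposition of a position into row and column is uniform in b and s, so one formula can be
    read at any increasing tuple of indices and at lists of naturals. *)
Lemma concat_position k n : exists pos : 'I_(k * n) -> 'I_k * 'I_n,
  forall d (I : orderType d) X (b : I -> n.-tuple X) (s : k.-tuple I) i,
    tnth (concat b s) i = tnth (b (tnth s (pos i).1)) (pos i).2.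
Proof.
have isum (i : 'I_(k * n)) : (i < sumn (nseq k n))%N.
  by rewrite sumn_nseq [X in (_ < X)%N]mulnC ltn_ord.
have row (i : 'I_(k * n)) : (reshape_index (nseq k n) i < k)%N.
  by have := reshape_indexP (isum i); rewrite size_nseq.
have col (i : 'I_(k * n)) : (reshape_offset (nseq k n) i < n)%N.
  by have := reshape_offsetP (isum i); rewrite nth_nseq row.
exists (fun i => (Ordinal (row i), Ordinal (col i))) => d I X b s i /=.
pose x0 := tnth (concat b s) i; rewrite [LHS](tnth_nth x0) /= nth_flatten.
have shE (l : seq I) : shape [seq tval (b j) | j <- l] = nseq (size l) n.
  by elim: l => //= j l ->; rewrite size_tuple.
rewrite shE size_tuple.
rewrite (nth_map (tnth s (Ordinal (row i)))) ?size_tuple ?row //.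
by rewrite [RHS](tnth_nth x0) /= [in RHS](tnth_nth (tnth s (Ordinal (row i)))).
Qed.

Section Morley.
Context {K : Type} {L : language} {C : structure L}.
Hypothesis K_unc : ~ countable [set: K].
Hypothesis C_sat : saturated K C.

Lemma small_prod_ord (I : Type) n :
  small K [set: I] -> small K [set: I * 'I_n].
Proof.
move=> sI; have aux m : small K [set v : I * 'I_n | (v.2 < m)%N].
  elim: m => [|m IH].
    apply: small_countable => //; rewrite (_ : [set _ | _] = set0).
      exact: countable0.
    by apply/seteqP; split=> // v /=; rewrite ltn0.
  have [mn|nm] := ltnP m n; last first.
    by apply: small_sub IH => v _ /=; apply: leq_trans (ltn_ord v.2) nm.
  apply: (@small_sub _ _ _ ([set v : I * 'I_n | (v.2 < m)%N] `|`
      (fun i => (i, Ordinal mn)) @` setT)).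
    move=> [i j] /=; rewrite ltnS leq_eqVlt => /orP[/eqP jm|]; last by left.
    by right; exists i => //; congr pair; exact: val_inj.
  by apply: small_setU => //; exact: small_image.
by apply: small_sub (aux n) => v _ /=; exact: ltn_ord.
Qed.

Definition indexed (I : Type) n (a : I -> n.-tuple C) : I * 'I_n -> C :=
  fun v => tnth (a v.1) v.2.

(* An indiscernible sequence modelled on a: its type is the iterated limit of
   the types of finite subsequences of a along an ultrafilter on nat. *)
Lemma indiscernible_extraction (B : set C) n (a : nat -> n.-tuple C)
    (d : Order.disp_t) (I : orderType d) :
  small K B -> small K [set: I] ->
  exists2 b : I -> n.-tuple C, indiscernible B b &
    forall P, definable setT B P -> P (indexed b) -> forall f : seq I,
      exists2 sigma : I -> nat,
        {in f &, {homo sigma : i j / (i < j)%O >-> (i < j)%N}} &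
        P (indexed (a \o sigma)).
Proof.
move=> sB sI; have [U [UU U_inf]] := ultraFilterLemma eventually_filter.
have FF := @increasing_filter_proper U UU d I.
pose G := [set P : set (I * 'I_n -> C) |
  @increasing_filter U d I [set sigma | P (indexed (a \o sigma))]].
have GG : ProperFilter G.
  split; first exact: (filter_not_empty (@increasing_filter U d I)).
  split=> [|P Q GP GQ|P Q PQ]; first exact: (@filterT _ (@increasing_filter U d I)).
    exact: (@filterI _ (@increasing_filter U d I) _ _ _ GP GQ).
  by apply: (@filterS _ (@increasing_filter U d I)) => sigma; exact: PQ.
have [e eP] := saturated_filter K_unc C_sat GG (small_prod_ord (n := n) sI) sB.
pose b i := [tuple e (i, j) | j < n].
have bE : indexed b = e.
  by apply/funext => -[i j]; rewrite /indexed /= tnth_mktuple.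
exists b => [k|P dP]; last first.
  rewrite bE => Pe f; apply: contrapT => nf.
  apply: (eP _ (definable_not dP)) Pe; rewrite /G /=.
  apply: (@filterS _ (@increasing_filter U d I) _ _ _ _ (increasing_filter_mono U_inf f)).
  move=> sigma sf Ps.
  by apply: nf; exists sigma.
have [pos posE] := concat_position k n.
pose at_seq t i := tnth (a (nth 0 t (pos i).1)) (pos i).2.
pose at_tuple (s : k.-tuple I) (e' : I * 'I_n -> C) :=
  [tuple e' (tnth s (pos i).1, (pos i).2) | i < k * n].
have dat psi (s : k.-tuple I) : over B psi ->
    definable setT B (fun e' => sat psi (at_tuple s e')).
  move=> psiB; pose f i : I * 'I_n + C := inl (tnth s (pos i).1, (pos i).2).
  exact: (@definable_subst _ _ _ _ setT _ _ f _ (fun _ _ => Logic.I) (definable_sat psiB)).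
have atE (s : k.-tuple I) : at_tuple s e = concat b s.
  by apply: eq_from_tnth => i; rewrite posE !tnth_mktuple.
have almost_G (Q : (k * n).-tuple C -> Prop) (s : k.-tuple I) : sorted <%O s ->
    @almost U k (fun t => Q [tuple at_seq t i | i < k * n]) ->
    G (fun e' => Q (at_tuple s e')).
  move=> ss aQ; exists s; split=> //; rewrite size_tuple.
  apply: almost_sub aQ => t _ Qt sigma st.
  suff tE : at_tuple s (indexed (a \o sigma)) = [tuple at_seq t i | i < k * n].
    by rewrite /= tE.
  apply: eq_from_tnth => i; rewrite !tnth_mktuple /at_seq -st /indexed /=.
  by rewrite (nth_map (tnth s (pos i).1)) ?size_tuple // -tnth_nth.
have aux (s t : k.-tuple I) psi : sorted <%O s -> sorted <%O t -> over B psi ->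
    sat psi (concat b s) -> sat psi (concat b t).
  move=> ss ts psiB; rewrite -!atE => psis.
  (* The ultrafilter decides psi on k-tuples of naturals, without reference to s or t; both
     therefore receive the same answer. *)
  have [aQ|aQ] := @almost_not U UU k (fun t => sat psi [tuple at_seq t i | i < k * n]).
    exact: (eP _ (dat psi t psiB) (almost_G _ t ts aQ)).
  have := eP _ (definable_not (dat psi s psiB)) (almost_G (fun x => ~ sat psi x) s ss aQ).
  by case.
move=> s t ss ts; apply/seteqP; split=> psi [psiB psis]; split=> //.
  exact: aux psis.
exact: aux psis.
Qed.

Lemma independent_seq (A B : set C) n (p : set (pformula C n)) :
  small K B -> p `<=` over B -> ~ forks A p ->
  exists a : nat -> n.-tuple C, forall i, realizes (a i) p /\
    ~ forks A (tp (a i) (B `|` \bigcup_(j in [set j | (j < i)%N]) range (tnth (a j)))).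
Proof.
move=> sB pB nfp.
pose past := foldr (fun (t : n.-tuple C) W => range (tnth t) `|` W) (set0 : set C).
have spast s : small K (past s).
  elim: s => [|t s IH] /=; first by apply: small_countable => //; exact: countable0.
  by apply: small_setU => //; exact: small_range.
have pastP t s : List.In t s -> range (tnth t) `<=` past s.
  by elim: s => [//|t' s IH] /= [->|/IH tS] x; [left|right; exact: tS].
have [|a aP] := @history_choice _ (fun s t =>
    realizes t p /\ ~ forks A (tp t (B `|` past s))).
  move=> s; have [|c cp nfc] := extension K_unc C_sat
    (small_setU K_unc sB (spast s)) _ pB nfp; first by move=> x; left.
  by exists c.
exists a => i; have [s [ra nfa] sP] := aP i; split=> // fk; apply: nfa.
apply: forks_tp_sub fk => // x [Bx|[j /= /sP/pastP h ax]]; first by left.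
by right; exact: h.
Qed.

End Morley.

Lemma monster_uncountable K L (T : theory L) (C : structure L) :
  monster K T C -> ~ countable [set: K].
Proof.
move=> [sL _ _ _] Kc; apply: sL; apply: card_le_trans Kc _.
by apply/setT_card_leP; exists inr; split=> // x y [].
Qed.

Theorem corollary7 (L : language) (T : theory L) (K : Type) (C : structure L)
  (T_complete : complete_theory T) (C_monster : monster K T C)
  (T_simple : simple C)
  (A B : set C) (A_small : small K A) (B_small : small K B) (AB : A `<=` B)
  (n : nat) (p : set (pformula C n)) (p_type : complete_types B p)
  (p_nf : ~ forks A p)
  (d : Order.disp_t) (I : orderType d) (I_small : small K [set: I]) :
  exists b : I -> n.-tuple C, morley_sequence A B p b.
Proof.
have K_unc := monster_uncountable C_monster.
have [_ _ C_sat C_hom] := C_monster; have [pB p_cons p_compl] := p_type.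
have [a aP] := independent_seq K_unc C_sat B_small pB p_nf.
have [b b_indisc bP] := indiscernible_extraction K_unc C_sat a B_small I_small.
have bp i : realizes (b i) p.
  move=> psi ppsi; apply: contrapT => npsi.
  pose P (e : I * 'I_n -> C) := ~ sat psi [tuple e (i, j) | j < n].
  have dP : definable setT B P.
    apply: definable_not; pose f (j : 'I_n) : I * 'I_n + C := inl (i, j).
    exact: (@definable_subst _ _ _ _ setT _ _ f _ (fun _ _ => Logic.I)
      (definable_sat (pB _ ppsi))).
  have tE (t : I -> n.-tuple C) : [tuple indexed t (i, j) | j < n] = t i.
    by apply: eq_from_tnth => j; rewrite tnth_mktuple.
  have [|sigma _] := bP P dP _ [::]; first by rewrite /P tE.
  by rewrite /P tE; apply; exact: (aP (sigma i)).1.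
exists b; split=> // i; split=> // /forks_tpP[[r psi w] [/= wB psib fpsi]].
(* Each entry of w is named by an element of B or by a coordinate of some earlier b_j, so that it
   can be re-evaluated along a. *)
have [v vP] : {v : 'I_r -> I * 'I_n + C & forall j,
    within [set x | (x.1 < i)%O] B (v j) /\ value (indexed b) (v j) = tnth w j}.
  apply: (@choice _ _ (fun j s => within [set x : I * 'I_n | (x.1 < i)%O] B s /\
    value (indexed b) s = tnth w j)) => j.
  have [Bw|[i' i'i [l _ <-]]] := wB _ (ex_intro2 _ _ j Logic.I erefl).
    by exists (inr (tnth w j)).
  by exists (inl (i', l)).
have fw : forks A (tp (b i) (A `|` range (tnth w))).
  by apply/forks_tpP; exists (PForm psi w); split=> // x; right.
(* The parameters u of the forking formula now lie in A b_i. *)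
have /forks_tpP[[q chi u] [/= uA chiw fchi]] :
    forks A (tp w (A `|` range (tnth (b i)))).
  apply: contrapT => nf.
  exact: (symmetry K_unc C_sat C_hom T_simple A_small nf fw).
have [v' v'P] : {v' : 'I_q -> I * 'I_n + C & forall j,
    within [set x | x.1 = i] A (v' j) /\ value (indexed b) (v' j) = tnth u j}.
  apply: (@choice _ _ (fun j s => within [set x : I * 'I_n | x.1 = i] A s /\
    value (indexed b) s = tnth u j)) => j.
  have [Au|[l _ <-]] := uA _ (ex_intro2 _ _ j Logic.I erefl).
    by exists (inr (tnth u j)).
  by exists (inl (i, l)).
pose w_at e := [tuple value e (v j) | j < r].
pose u_at e := [tuple value e (v' j) | j < q].
pose P (e : I * 'I_n -> C) := sat (PForm chi (u_at e)) (w_at e).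
have dP : definable setT B P.
  exists (r + q), chi, (fun j => match fintype.split j with
    inl j => v j | inr j => v' j end).
  split=> [j|e].
    case: fintype.split => {}j.
      by have [] := vP j; case: (v j).
    by have [] := v'P j; case: (v' j) => //= c /AB.
  rewrite /P /sat /= (_ : [tuple of _ ++ _] = [tuple value e
    match fintype.split j with inl j => v j | inr j => v' j end | j < r + q]) //.
  apply: eq_from_tnth => j; rewrite tnth_mktuple.
  by case: (splitP j) => j' jj; [rewrite (_ : j = lshift _ j')|rewrite (_ : j = rshift _ j')];
    rewrite ?tnth_lshift ?tnth_rshift ?tnth_mktuple //; apply: val_inj.
have wE : w_at (indexed b) = w.
  by apply: eq_from_tnth => j; rewrite tnth_mktuple (vP j).2.
have uE : u_at (indexed b) = u.
  by apply: eq_from_tnth => j; rewrite tnth_mktuple (v'P j).2.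
(* The index i is a harmless default for entries of w from B. Since sigma is increasing on i and the
   indices used by w, the new copy of w lies before [sigma i]. *)
pose idx (s : I * 'I_n + C) := if s is inl x then x.1 else i.
have [|sigma sigma_mono] := bP P dP _ (i :: [seq idx (v j) | j <- enum 'I_r]).
  by rewrite /P wE uE.
set e := indexed (a \o sigma) => Pe.
(* Completeness of p is used here: [b i] and [a (sigma i)] both realize p, hence have the same type
   over B. *)
have [g [ga gA gb]] : conjugate A (b i) (a (sigma i)).
  apply: tp_conjugate C_hom _ _; first by apply: small_setU => //; exact: small_range.
  move=> phi phiA phib; have phiB : over B phi by move=> x /phiA/AB.
  have [/((aP (sigma i)).1)//|/(bp i)] := p_compl _ phiB.
  by rewrite /sat /= => /(_ phib).
have gu : map_tuple g u = u_at e.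
  apply: eq_from_tnth => j; rewrite tnth_map tnth_mktuple -(v'P j).2.
  case: (v' j) (v'P j).1 => [[i' l] /= ->|c /gA //].
  by rewrite /e /indexed /= -gb tnth_map.
have [h [ha gK hK]] := automorphism_inv ga.
(* The automorphism g carries chi(y, u) to chi(y, [u_at e]), which therefore still forks over A,
   whatever the type of [w_at e] may be. *)
have fw' : forks A (tp (w_at e) (A `|` range (tnth (a (sigma i))))).
  apply/forks_tpP; exists (PForm chi (u_at e)); split=> //.
    move=> _ [j _ <-] /=; rewrite tnth_mktuple.
    case: (v' j) (v'P j).1 => [[i' l] /= ->|c]; last by left.
    by right; exists l.
  apply: (forking_set_automorphism ha _ _ fchi).
    by move=> x Ax; rewrite -[in LHS](gA x Ax) gK.
  move=> y; rewrite /= -gu (sat_automorphism _ _ _ ha).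
  by rewrite (_ : map_tuple h (map_tuple g u) = u) //;
    apply: eq_from_tnth => j; rewrite !tnth_map gK.
have := aP (sigma i) => -[_]; apply.
have {}fw' : forks A (tp (a (sigma i)) (A `|` range (tnth (w_at e)))).
  apply: contrapT => nf.
  exact: (symmetry K_unc C_sat C_hom T_simple A_small nf fw').
apply: forks_tp_sub fw' => // x [/AB|[j _ <-]]; first by left.
rewrite tnth_mktuple; have := (vP j).1.
case vj : (v j) => [[i' l]|c] /=; last by left.
move=> i'i; right; exists (sigma i'); last by exists l.
apply: sigma_mono i'i; rewrite ?mem_head // inE; apply/orP; right.
by apply/mapP; exists j; rewrite ?mem_enum // vj.
Qed.
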